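(* Let $p, q\in(1,\infty)$. Then, there exist constants $\gamma_2, \gamma_3, \ldots$, independent of $m$, such that for $m$ large enough $$I_{p,q}(m) \sim \frac{1}{q} \Gamma \left(\frac{1}{q}\right) (p(q+1))^{1/q} \left[ 1-\frac{(q+1)(pq^2+2pq-3q^2+p-2q)}{2q^2(2q+1)}\frac{1}{m}\right] +\frac{1}{q}\sum_{j=2}^\infty \Gamma\left(j+\frac{1}{q}\right)\frac{\gamma_j}{m^j}.$$
   Context: The notation $f(x)\sim g(x)$ means $f(x)/g(x)\to 1$ as $x\to\infty$ (here the variable is $m$). For $m,p,q\in(1,\infty)$, $$I_{p,q}(m):=m^{1/q}\int_0^\infty \left|\frac{\sin_{p,q}x}{x}\right|^m dx.$$ For $p,q\in(1,\infty)$ let $F_{p,q}(x)=\int_0^x (1-t^q)^{-1/p}\,dt$ for $x\in[0,1]$, and let $\pi_{p,q}:=2F_{p,q}(1)$. The generalised sine function $\sin_{p,q}$ is defined on $[0,\pi_{p,q}/2]$ as the inverse of $F_{p,q}:[0,1]\to[0,\pi_{p,q}/2]$, and is extended to all of $\mathbb{R}$ as a $2\pi_{p,q}$-periodic function by means of $\sin_{p,q}x=\sin_{p,q}(\pi_{p,q}-x)$ and $\sin_{p,q}(-x)=-\sin_{p,q}x$. The function $(\sin_{p,q}x)/x$ is given the value $1$ at $x=0$. $\Gamma$ is the gamma function. *)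

(* Defs.v *)
From HB Require Import structures.
From mathcomp Require Import all_boot all_order all_algebra.
From mathcomp Require Import all_classical all_reals all_analysis.

Set Implicit Arguments.
Unset Strict Implicit.
Unset Printing Implicit Defensive.

Import Order.TTheory GRing.Theory Num.Theory.
Import numFieldNormedType.Exports.

Local Open Scope classical_set_scope.
Local Open Scope ring_scope.

Section Gsin.
Context {R : realType}.
Implicit Types p q m x : R.

Local Notation mu := (@lebesgue_measure R).

(* The integrand is unbounded near [t = 1]; its value at [t = 1] itself is [0]
   by the convention of [powR], which does not affect the integral. *)
Definition garcsin p q x : R :=
  \int[mu]_(t in `[0, x]) (1 - t `^ q) `^ (- p^-1).

Definition gpi p q : R := 2 * garcsin p q 1.

(* The inverse of [garcsin p q : [0, 1] -> [0, gpi p q / 2]], reflected to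
   [[0, gpi p q]]. *)
Definition gsin_half p q x : R :=
  let arc := 'pinv_(fun=> 0) `[0, 1] (garcsin p q) in
  if x <= gpi p q / 2 then arc x else arc (gpi p q - x).

(* The odd, [2 * gpi p q]-periodic extension; [r] is the representative of [x]
   in [[0, 2 * gpi p q[]. On [[gpi p q, 2 * gpi p q[], oddness and periodicity
   give [sin r = - sin (2 * gpi p q - r)]. *)
Definition gsin p q x : R :=
  let T := 2 * gpi p q in
  let r := x - T * (Num.floor (x / T))%:~R in
  if r <= gpi p q then gsin_half p q r else - gsin_half p q (T - r).

Definition gsinc p q x : R := if x == 0 then 1 else gsin p q x / x.

Definition Ipq p q m : R :=
  m `^ q^-1 * \int[mu]_(x in `[0, +oo[) (`|gsinc p q x| `^ m).

Definition Gamma (z : R) : R :=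
  \int[mu]_(t in `]0, +oo[) (t `^ (z - 1) * expR (- t)).

Definition asymp_equiv (f g : R -> R) : Prop :=
  f m / g m @[m --> +oo] --> (1 : R).

(* [S N] is the partial sum, up to the term in [m ^- N], of a formal series in
   powers of [1 / m]; the series need not converge. The first clause says that
   every partial sum is equivalent to [f], the second that
   [f - S N = o(m ^- N)], so that the series is the asymptotic expansion of [f]
   in the sense of Poincare. *)
Definition asymp_series (f : R -> R) (S : nat -> R -> R) : Prop :=
  forall N : nat,
    asymp_equiv f (S N) /\
    (f m - S N m) * m ^+ N @[m --> +oo] --> (0 : R).

End Gsin.

(* Main.v *)
Require Import Defs.
From HB Require Import structures.
From mathcomp Require Import all_boot all_order all_algebra.
From mathcomp Require Import all_classical all_reals all_analysis.
From mathcomp Require Import measurable_realfun ring lra.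

Set Implicit Arguments.
Unset Strict Implicit.
Unset Printing Implicit Defensive.

Import Order.TTheory GRing.Theory Num.Theory.
Import numFieldNormedType.Exports.

Local Open Scope classical_set_scope.
Local Open Scope ring_scope.

(** Write [F] for [garcsin p q] and [X = F 1], half of [gpi p q]. The expansion comes
    from Laplace's method at the origin, applied after the substitution [x = F s],
    which removes the inverse function: for [0 < s0 < 1],
      [\int_0^(F s0) (gsin x / x)^m dx = \int_0^s0 (s / F s)^m (1 - s^q)^(-1/p) ds]
    ([gsinc_substitution]). What is left out is exponentially small in [m], because
    [|gsinc x|] stays below some [rho < 1] beyond [F s0] and is at most [1 / x]
    ([gsinc_tail_integral]).

    Put [u = s^q]. Integrating the binomial series of [(1 - u)^(-1/p)] term by term
    shows that [F s / s] is a function [phi u] with an expansion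
    [1 + a u + b u^2 + ...], where [a = 1 / (p (q + 1))] ([arc_ratio_approx]). Hence
    [ln (phi u) = a u + r u * u^2], where [r] has expansions of every order and
    [r 0 = b - a^2 / 2] ([poly_approx_ln_remainder]), and the integrand is
      [exp (- m a u) * exp (- m u^2 r u) * (1 - u)^(-1/p)].
    The Taylor polynomial of the second exponential, together with the expansions of
    [(r u)^l (1 - u)^(-1/p)], turns this into a finite sum of terms
    [m^l u^(2 l + k) exp (- m a u)]. In the variable [y = m u] the error after [N]
    terms is [m^(- N)] times a power of [y] times [exp (- a y / 2)], hence
    [O (m^(- N) exp (- a y / 4))] uniformly on the half-line ([laplace_pointwise]).

    Integrating in [s], each term is a moment of [exp (- m a s^q)], which is
    [Gamma (2 l + k + 1/q)] up to elementary factors ([moment_scale]), and it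
    contributes to the coefficient of [m^(- l - k)] ([laplace_integral]). The
    polynomials in [1 / m] obtained for the various orders [N] agree where they
    overlap, because a polynomial that is [O (x^N)] at the origin has no term of lower
    degree; this provides one sequence of coefficients for all orders. The first two
    are computed from [l + k <= 1] with [Gamma (z + 1) = z Gamma z] at [z = 1/q] and
    [z = 1 + 1/q] ([Gamma_succ]), and the remaining ones may be divided by
    [Gamma (j + 1/q)], which is positive. *)

(** * Polynomial approximation at the origin *)

Section PolyApprox.
Context {R : realType}.
Implicit Types (d : R) (f g v : R -> R) (P Q : {poly R}) (n : nat).

(** Existential statements [exists P, poly_approx d f P n] for every [n] say that [f] has
    an asymptotic expansion at [0+]. The degree of [P] is unrestricted, so that sums,
    products and compositions of approximating polynomials approximate as they stand. *)
Definition poly_approx d f P n : Prop :=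
  exists C : R, forall u, 0 < u <= d -> `|f u - P.[u]| <= C * u ^+ n.

Definition bounded_on d f : Prop :=
  exists B : R, 0 <= B /\ forall u, 0 < u <= d -> `|f u| <= B.

Lemma poly_approxP d f P n : poly_approx d f P n ->
  exists C : R, 0 <= C /\ forall u, 0 < u <= d -> `|f u - P.[u]| <= C * u ^+ n.
Proof.
move=> [C HC]; exists `|C|; split=> // u ud.
apply: le_trans (HC u ud) _; rewrite ler_wpM2r ?ler_norm// exprn_ge0//.
by case/andP: ud => /ltW.
Qed.

Lemma bounded_on_horner d P : bounded_on d (horner P).
Proof.
elim/poly_ind: P => [|P c [B [B0 HB]]].
  by exists 0; split=> // u _; rewrite horner0 normr0.
exists (B * `|d| + `|c|); split=> [|u /[dup] ud /andP[u0 ule]].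
  by rewrite addr_ge0// mulr_ge0.
rewrite hornerMXaddC (le_trans (ler_normD _ _))// lerD2r normrM.
by rewrite ler_pM// ?HB// ger0_norm ?(ltW u0)// (le_trans ule)// ler_norm.
Qed.

Lemma poly_approx_bounded d f P n : poly_approx d f P n -> bounded_on d f.
Proof.
move=> /poly_approxP[C [C0 HC]]; have [B [B0 HB]] := bounded_on_horner d P.
exists (C * `|d| ^+ n + B); split=> [|u ud].
  by rewrite addr_ge0// mulr_ge0// exprn_ge0.
rewrite -[f u](subrK P.[u]) (le_trans (ler_normD _ _))// lerD ?HB//.
case/andP: (ud) => u0 ule.
rewrite (le_trans (HC u ud))// ler_wpM2l// lerXn2r ?nnegrE//; first exact: ltW.
by rewrite (le_trans ule)// ler_norm.
Qed.

Lemma poly_approx_horner d P n : poly_approx d (horner P) P n.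
Proof. by exists 0 => u _; rewrite subrr normr0 mul0r. Qed.

Lemma poly_approx_ext d f g P n : (forall u, 0 < u <= d -> f u = g u) ->
  poly_approx d f P n -> poly_approx d g P n.
Proof. by move=> fg [C HC]; exists C => u ud; rewrite -fg// HC. Qed.

Lemma poly_approxD d f g P Q n : poly_approx d f P n -> poly_approx d g Q n ->
  poly_approx d (fun u => f u + g u) (P + Q) n.
Proof.
move=> [C HC] [D HD]; exists (C + D) => u ud.
by rewrite hornerD opprD addrACA (le_trans (ler_normD _ _))// mulrDl lerD ?HC ?HD.
Qed.

Lemma poly_approxM d f g P Q n : poly_approx d f P n -> poly_approx d g Q n ->
  poly_approx d (fun u => f u * g u) (P * Q) n.
Proof.
move=> fP gQ; have [B [B0 HB]] := poly_approx_bounded fP.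
have [E [E0 HE]] := bounded_on_horner d Q.
move: fP gQ => /poly_approxP[C [C0 HC]] /poly_approxP[D [D0 HD]].
exists (B * D + C * E) => u ud; rewrite hornerM.
have -> : f u * g u - P.[u] * Q.[u] = f u * (g u - Q.[u]) + (f u - P.[u]) * Q.[u].
  by ring.
have un0 : 0 <= u ^+ n by rewrite exprn_ge0//; case/andP: ud => /ltW.
rewrite (le_trans (ler_normD _ _))// !normrM mulrDl lerD//.
  by rewrite -mulrA ler_pM// ?HB ?HD.
by rewrite mulrAC ler_pM// ?HC ?HE.
Qed.

(** The approximating polynomial may be modified from degree [n] on. *)
Lemma poly_approx_subst d f P Q n S : poly_approx d f P n ->
  (forall u, P.[u] - Q.[u] = u ^+ n * S.[u]) -> poly_approx d f Q n.
Proof.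
move=> [C HC] PQ; have [B [B0 HB]] := bounded_on_horner d S.
exists (C + B) => u ud.
have un0 : 0 <= u ^+ n by rewrite exprn_ge0//; case/andP: ud => /ltW.
have -> : f u - Q.[u] = (f u - P.[u]) + (P.[u] - Q.[u]) by ring.
rewrite (le_trans (ler_normD _ _))// mulrDl lerD ?HC//.
by rewrite PQ normrM mulrC ler_pM// ?HB// ger0_norm.
Qed.


Lemma poly_approx_le d f P n k : 0 <= d -> (n <= k)%N -> poly_approx d f P k ->
  poly_approx d f P n.
Proof.
move=> d0 nk /poly_approxP[C [C0 HC]]; exists (C * d ^+ (k - n)) => u ud.
rewrite (le_trans (HC u ud))// -mulrA ler_wpM2l// -[in leLHS](subnK nk) exprD.
case/andP: (ud) => /ltW u0 ule.
by rewrite ler_wpM2r ?exprn_ge0// lerXn2r ?nnegrE.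
Qed.

Lemma poly_approx_restr d e f P n : e <= d -> poly_approx d f P n ->
  poly_approx e f P n.
Proof.
move=> ed [C HC]; exists C => u /andP[u0 ue]; apply: HC.
by rewrite u0 (le_trans ue).
Qed.


Lemma norm_le_linear_eq0 (d K c : R) : 0 < d ->
  (forall u, 0 < u <= d -> `|c| <= K * u) -> c = 0.
Proof.
move=> d0 HK; apply/eqP; rewrite -normr_le0 leNgt; apply/negP => c0.
have K0 : 0 < K.
  have := HK d; rewrite d0 lexx => /(_ isT) /(lt_le_trans c0).
  by rewrite pmulr_lgt0.
pose u := Num.min d (`|c| / (2 * K)).
have u0 : 0 < u by rewrite lt_min d0 divr_gt0// mulr_gt0.
have := HK u; rewrite u0 ge_min lexx => /(_ isT); apply/negP; rewrite -ltNge.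
have : u <= `|c| / (2 * K) by rewrite ge_min lexx orbT.
rewrite ler_pdivlMr ?mulr_gt0// => uK; apply: lt_le_trans (_ : u * (2 * K) <= _) => //.
by rewrite mulrC mulrCA ltr_pMl ?mulr_gt0// ltr1n.
Qed.

Lemma drop1_polyE P : P = drop_poly 1 P * 'X + (P`_0)%:P.
Proof.
apply/polyP => i; rewrite coefD coefMX coefC coef_drop_poly.
by case: i => [|i] /=; rewrite ?add0r// addr0 addn1.
Qed.

(** The constant coefficient is [O(u)], hence zero; dividing by [u] repeats the
    argument. This makes the low coefficients of an approximation unique. *)
Lemma small_poly_coef d P n C : 0 < d ->
  (forall u, 0 < u <= d -> `|P.[u]| <= C * u ^+ n) ->
  forall k, (k < n)%N -> P`_k = 0.
Proof.
move=> d0; elim: n P => // n IH P HC.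
have P0 : P`_0 = 0.
  have [B [B0 HB]] := bounded_on_horner d (drop_poly 1 P).
  apply: (@norm_le_linear_eq0 d (`|C| * d ^+ n + B)) => // u /[dup] ud /andP[u0 ule].
  have -> : P`_0 = P.[u] - (drop_poly 1 P).[u] * u.
    by rewrite [in P.[u]](drop1_polyE P) hornerMXaddC; ring.
  rewrite (le_trans (ler_normB _ _))// mulrDl lerD//.
    rewrite (le_trans (HC u ud))// exprSr mulrA ler_wpM2r//; first exact: ltW.
    have un0 : 0 <= u ^+ n by rewrite exprn_ge0// ltW.
    rewrite (le_trans (ler_norm _))// normrM ler_wpM2l// (ger0_norm un0).
    by rewrite lerXn2r ?nnegrE//; exact: ltW.
  by rewrite normrM (gtr0_norm u0) ler_wpM2r ?HB//; exact: ltW.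
case=> [//|k]; rewrite ltnS => kn.
rewrite -addn1 -coef_drop_poly; apply: (IH (drop_poly 1 P)) => // u /[dup] ud /andP[u0 ule].
have := HC u ud; rewrite {1}(drop1_polyE P) P0 hornerMXaddC addr0 normrM.
by rewrite (gtr0_norm u0) exprSr mulrA ler_pM2r.
Qed.

Lemma poly_approx_coef d f P Q n : 0 < d -> poly_approx d f P n ->
  poly_approx d f Q n -> forall k, (k < n)%N -> P`_k = Q`_k.
Proof.
move=> d0 [C HC] [D HD] k kn; apply/eqP; rewrite -subr_eq0 -coefB; apply/eqP.
apply: (@small_poly_coef d _ n (C + D)) kn => // u ud.
have -> : (P - Q).[u] = (f u - Q.[u]) - (f u - P.[u]).
  by rewrite hornerD hornerN; ring.
by rewrite (le_trans (ler_normB _ _))// mulrDl addrC lerD ?HC ?HD.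
Qed.

Lemma poly_approx_trunc d f P n : poly_approx d f P n ->
  poly_approx d f (take_poly n P) n.
Proof.
move/(@poly_approx_subst d f P (take_poly n P) n (drop_poly n P)); apply=> u.
by rewrite -{1}(poly_take_drop n P) hornerD hornerM hornerXn; ring.
Qed.

(** By uniqueness of the low coefficients, approximations of every order come from a
    single formal power series. *)
Lemma poly_approx_series d f : 0 < d -> (forall n, exists P, poly_approx d f P n) ->
  exists c : nat -> R, forall n, poly_approx d f (\poly_(k < n) c k) n.
Proof.
move=> d0 /choice[P HP]; exists (fun k => (P k.+1)`_k) => n.
rewrite (_ : \poly_(k < n) _ = take_poly n (P n)); first exact: poly_approx_trunc.
apply/polyP => k; rewrite coef_poly coef_take_poly; case: ltnP => // kn.
apply: (@poly_approx_coef d f _ _ k.+1) => //.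
by apply: poly_approx_le (HP n); rewrite // ltW.
Qed.

Lemma poly_approx_div d f P n : P`_0 = 0 -> poly_approx d f P n.+1 ->
  poly_approx d (fun u => f u / u) (drop_poly 1 P) n.
Proof.
move=> P0 [C HC]; exists C => u /[dup] ud /andP[u0 ule].
rewrite -(ler_pM2r u0) -mulrA -exprSr (le_trans _ (HC u ud))//.
rewrite -[X in _ * X <= _](gtr0_norm u0) -normrM mulrBl mulfVK ?gt_eqF//.
by rewrite [in P.[u]](drop1_polyE P) P0 hornerMXaddC addr0.
Qed.

Lemma poly_approx_comp d e f v P Q n :
  (forall u, 0 < u <= d -> 0 < v u <= e) ->
  (exists K, forall u, 0 < u <= d -> v u <= K * u) ->
  poly_approx e f P n -> poly_approx d v Q n ->
  poly_approx d (fun u => f (v u)) (P \Po Q) n.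
Proof.
move=> ve [K HK] /poly_approxP[C [C0 HC]] vQ.
have [D HD] : poly_approx d (fun u => P.[v u]) (P \Po Q) n.
  elim/poly_ind: P {HC} => [|P c IH].
    rewrite comp_poly0.
    by apply: poly_approx_ext (poly_approx_horner _ _ _) => u _; rewrite !horner0.
  rewrite comp_polyD comp_polyM comp_polyX comp_polyC.
  apply: poly_approx_ext (poly_approxD (poly_approxM IH vQ) (poly_approx_horner d c%:P n)).
  by move=> u _; rewrite hornerMXaddC hornerC.
exists (C * K ^+ n + D) => u ud; have /andP[vu0 vue] := ve u ud.
have -> : f (v u) - (P \Po Q).[u] = (f (v u) - P.[v u]) + (P.[v u] - (P \Po Q).[u]).
  by ring.
rewrite (le_trans (ler_normD _ _))// mulrDl lerD ?HD//.
rewrite (le_trans (HC _ (ve u ud)))// -mulrA ler_wpM2l// -exprMn lerXn2r ?nnegrE//.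
- exact: ltW.
- by rewrite (le_trans (ltW vu0))// HK.
- exact: HK.
Qed.


Lemma poly_approxX d f P n k : poly_approx d f P n ->
  poly_approx d (fun u => f u ^+ k) (P ^+ k) n.
Proof.
move=> fP; elim: k => [|k IH].
  rewrite expr0; apply: poly_approx_ext (poly_approx_horner _ _ _) => u _.
  by rewrite hornerC expr0.
rewrite exprS; apply: poly_approx_ext (poly_approxM fP IH) => u _.
by rewrite exprS.
Qed.

Lemma MVT_norm_le f df (x B : R) : 0 <= x ->
  (forall y, 0 < y < x -> is_derive y 1 f (df y)) ->
  {within `[0, x], continuous f} ->
  (forall y, 0 < y < x -> `|df y| <= B) -> `|f x - f 0| <= B * x.
Proof.
rewrite le_eqVlt => /predU1P[<- *|x0 fd fc dfB].
  by rewrite subrr normr0 mulr0.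
have fd' y : y \in `]0, x[ -> is_derive y 1 f (df y) by rewrite in_itv/=; exact: fd.
have [y + ->] := MVT x0 fd' fc; rewrite in_itv/= => yx.
by rewrite subr0 normrM (gtr0_norm x0) ler_wpM2r ?dfB// ltW.
Qed.

(** Integrating an approximation gains one order. *)
Lemma poly_approx_primitive d f g P n :
  (forall u, 0 <= u <= d -> is_derive u 1 f (g u)) -> f 0 = P.[0] ->
  poly_approx d g P^`() n -> poly_approx d f P n.+1.
Proof.
move=> fg f0 /poly_approxP[C [C0 HC]]; exists C => u /andP[u0 ule].
pose h := (f - horner P)%R.
have hd y : 0 <= y <= d -> is_derive y 1 h (g y - P^`().[y]).
  by move=> yd; have := fg y yd => fgy; exact: is_deriveB.
have := @MVT_norm_le h (fun y => g y - P^`().[y]) u (C * u ^+ n) (ltW u0).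
rewrite /h !fctE f0 subrr subr0 -mulrA -exprSr; apply.
- by move=> y /andP[y0 yu]; apply: hd; rewrite ltW//= (le_trans (ltW yu)).
- apply: derivable_within_continuous => y; rewrite in_itv/= => /andP[y0 yu].
  by apply: ex_derive; apply: hd; rewrite y0 (le_trans yu).
- move=> y /andP[y0 yu]; rewrite (le_trans (HC y _))//.
    by rewrite y0 (le_trans (ltW yu)).
  by rewrite ler_wpM2l// lerXn2r ?nnegrE// ltW.
Qed.

Lemma poly_approx_primitive_series d f g (b c : nat -> R) n :
  (forall u, 0 <= u <= d -> is_derive u 1 f (g u)) -> b 0 = f 0 ->
  (forall k, b k.+1 * k.+1%:R = c k) ->
  poly_approx d g (\poly_(k < n) c k) n ->
  poly_approx d f (\poly_(k < n.+1) b k) n.+1.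
Proof.
move=> fg b0 bc gc; apply: poly_approx_primitive fg _ _.
  by rewrite horner_coef0 coef_poly ltn0Sn b0.
rewrite (_ : _^`() = \poly_(k < n) c k)//.
apply/polyP => k; rewrite coef_deriv !coef_poly ltnS.
by case: ltnP => // _; rewrite ?mul0rn// -bc mulr_natr.
Qed.

(** Coefficient of [u^k] in [(1 - u)^(- al)]: a rising factorial over [k!]. *)
Definition binom_coef (al : R) k : R := \prod_(i < k) (al + i%:R) / k`!%:R.


Lemma is_derive_onem_powR (al u : R) : u < 1 ->
  is_derive u 1 (fun u => (1 - u) `^ (- al)) (al * (1 - u) `^ (- (al + 1))).
Proof.
move=> u1; have u1' : 0 < 1 - u by rewrite subr_gt0.
have D1 : is_derive u (1 : R) (cst (1 : R) - id) (0 - 1) by exact: is_deriveB.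
have /= := @is_derive1_comp R (fun x : R => x `^ (- al)) (cst 1 - id) u _ _
  (is_derive1_powR (- al) u1') D1.
move/trigger_derive; apply.
by rewrite sub0r mulrN1 mulNr opprK opprD.
Qed.

(** Differentiation maps [(1 - u)^(- al)] to [al (1 - u)^(- (al + 1))], so the remainder
    of order [n.+1] for [al] is the primitive of the one of order [n] for [al + 1]. *)
Lemma poly_approx_onem_powR d (al : R) n : 0 < d < 1 ->
  poly_approx d (fun u => (1 - u) `^ (- al)) (\poly_(k < n) binom_coef al k) n.
Proof.
move=> /andP[d0 d1]; elim: n al => [|n IH] al.
  exists (Num.max ((1 - d) `^ (- al)) 1) => u /andP[u0 ule].
  rewrite poly_def big_ord0 horner0 subr0 expr0 mulr1 ger0_norm ?powR_ge0// le_max.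
  have [al0|al0] := leP 0 al.
    apply/orP; left; rewrite !powRN lef_pV2 ?posrE ?powR_gt0 ?subr_gt0//.
      by rewrite ge0_ler_powR ?nnegrE ?subr_ge0 ?lerD2l ?lerN2// ?(le_trans ule)// ltW.
    exact: le_lt_trans d1.
  apply/orP; right; rewrite [leRHS](_ : 1 = 1 `^ (- al)); last by rewrite powR1.
  rewrite ge0_ler_powR ?nnegrE//.
  - by rewrite oppr_ge0 ltW.
  - by rewrite subr_ge0 (le_trans ule)// ltW.
  - by rewrite gerBl ltW.
apply: (@poly_approx_primitive_series _ _ (fun u => al * (1 - u) `^ (- (al + 1)))
  _ (fun k => al * binom_coef (al + 1) k)).
- by move=> u /andP[u0 ud]; apply: is_derive_onem_powR; exact: le_lt_trans d1.
- by rewrite /binom_coef big_ord0 fact0 divr1 subr0 powR1.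
- move=> k; rewrite /binom_coef big_ord_recl /= addr0 factS natrM.
  rewrite (eq_bigr (fun i : 'I_k => al + 1 + i%:R)); last first.
    by move=> i _; rewrite /bump /= natrD addrA.
  have k0 : k.+1%:R != 0 :> R by rewrite pnatr_eq0.
  by rewrite invfM mulrA mulrAC [in LHS]mulrA mulfK// mulrA.
- have := poly_approxM (poly_approx_horner d al%:P n) (IH (al + 1)).
  move/(poly_approx_ext (g := fun u => al * (1 - u) `^ (- (al + 1)))).
  have -> : al%:P * \poly_(k < n) binom_coef (al + 1) k =
            \poly_(k < n) (al * binom_coef (al + 1) k).
    by apply/polyP => k; rewrite coefCM !coef_poly; case: ifP; rewrite ?mulr0.
  by apply => u _; rewrite hornerC.
Qed.

(** The remainder of the geometric series is explicit, and integrating gives the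
    Mercator series. *)
Lemma poly_approx_inv1p d n : 0 < d ->
  poly_approx d (fun v : R => (1 + v)^-1) (\poly_(k < n) (-1) ^+ k) n.
Proof.
move=> d0; exists (1:R) => v /andP[v0 _].
have v1 : 0 < 1 + v by rewrite addr_gt0.
have -> : (\poly_(k < n) (-1) ^+ k).[v] = (1 - (- v) ^+ n) / (1 + v).
  apply: (mulIf (lt0r_neq0 v1)); rewrite divfK ?gt_eqF//.
  have -> : 1 - (- v) ^+ n = (1 - (- v)) * (\sum_(i < n) (- v) ^+ i).
    by rewrite -{1}(expr1n _ n) subrXX; congr (_ * _); apply: eq_bigr => i _;
      rewrite expr1n mul1r.
  rewrite opprK mulrC horner_poly; congr (_ * _); apply: eq_bigr => i _.
  by rewrite -exprMn mulN1r.
have -> : (1 + v)^-1 - (1 - (- v) ^+ n) / (1 + v) = (- v) ^+ n / (1 + v).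
  by rewrite mulrBl mul1r opprB addrCA subrr addr0.
rewrite normrM normfV normrX normrN (gtr0_norm v0) (gtr0_norm v1) mul1r.
have v0' := ltW v0; by rewrite ler_piMr ?exprn_ge0// invf_le1// lerDl.
Qed.

(** The coefficient at [k = 0] is [0] because [0^-1 = 0]. *)
Definition ln_coef k : R := (-1) ^+ k.+1 / k%:R.

Lemma poly_approx_ln1p d n : 0 < d ->
  poly_approx d (fun v : R => ln (1 + v)) (\poly_(k < n.+1) ln_coef k) n.+1.
Proof.
move=> d0; apply: poly_approx_primitive_series (poly_approx_inv1p n d0).
- move=> u /andP[u0 _]; have u1 : 0 < 1 + u by rewrite ltr_wpDr.
  have D1 : is_derive u (1 : R) (cst (1 : R) + id) (0 + 1) by exact: is_deriveD.
  have /= := @is_derive1_comp R (@ln R) (cst 1 + id) u _ _ (is_derive1_ln u1) D1.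
  by move/trigger_derive; apply; rewrite add0r mulr1.
- by rewrite /ln_coef invr0 mulr0 addr0 ln1.
- by move=> k; rewrite /ln_coef divfK ?pnatr_eq0// !exprS mulrA mulrNN !mul1r.
Qed.

Definition expR_taylor n (x : R) : R := \sum_(l < n) x ^+ l / l`!%:R.

Lemma is_derive_expR_taylor n (x : R) :
  is_derive x (1 : R) (expR_taylor n.+1) (expR_taylor n x).
Proof.
have -> : expR_taylor n.+1 = horner (\poly_(l < n.+1) l`!%:R^-1).
  apply/funext => y; rewrite horner_poly; apply: eq_bigr => i _; exact: mulrC.
have -> : expR_taylor n x = (\poly_(l < n.+1) l`!%:R^-1)^`().[x].
  rewrite (_ : _^`() = \poly_(l < n) l`!%:R^-1).
    by rewrite horner_poly; apply: eq_bigr => i _; exact: mulrC.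
  apply/polyP => k; rewrite coef_deriv !coef_poly ltnS.
  case: ltnP => // _; rewrite ?mul0rn//.
  by rewrite -[LHS]mulr_natr factS natrM invfM mulrAC mulVf ?mul1r// pnatr_eq0.
exact: is_derive_poly.
Qed.

(** Each remainder is a primitive of the previous one, vanishing at [0]. *)
Lemma expR_taylor_le n x :
  `|expR x - expR_taylor n x| <= `|x| ^+ n * expR `|x|.
Proof.
elim: n x => [|n IH] x.
  rewrite /expR_taylor big_ord0 subr0 ger0_norm ?expR_ge0// expr0 mul1r ler_expR.
  exact: ler_norm.
pose h y := expR y - expR_taylor n.+1 y.
have hd (y : R) : is_derive y (1 : R) h (expR y - expR_taylor n y).
  by apply: is_deriveB; exact: is_derive_expR_taylor.
have h0 : h 0 = 0.
  rewrite /h /expR_taylor big_ord_recl big1 ?addr0 ?expr0 ?fact0 ?divr1 ?expR0 ?subrr//.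
  by move=> i _; rewrite /= /bump /= add1n exprS !mul0r.
rewrite -/(h x); have [c cx ->] : exists2 c, `|c| <= `|x| & h x = (expR c - expR_taylor n c) * x.
  have hc a b : {within `[a, b], continuous h}.
    by apply: derivable_within_continuous => y _; apply: ex_derive; exact: hd.
  have [x0|x0] := leP 0 x.
    have [c + E] := MVT_segment x0 (fun y _ => hd y) (hc _ _).
    rewrite in_itv/= => /andP[c0 cx]; exists c.
      by rewrite !ger0_norm.
    by move: E; rewrite h0 !subr0.
  have [c + E] := MVT_segment (ltW x0) (fun y _ => hd y) (hc _ _).
  rewrite in_itv/= => /andP[cx c0]; exists c.
    by rewrite (ltr0_norm x0) ler0_norm// lerN2.
  by move: E; rewrite h0 !sub0r mulrN => /oppr_inj.
rewrite normrM exprSr mulrAC ler_wpM2r// (le_trans (IH c))//.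
by rewrite ler_pM ?exprn_ge0 ?expR_ge0 ?ler_expR ?lerXn2r ?nnegrE.
Qed.

(** If [phi u = 1 + c1 u + c2 u^2 + ...] then [ln (phi u)] begins with
    [c1 u + (c2 - c1^2 / 2) u^2], so subtracting [c1 u] and dividing twice by [u] is
    harmless; it costs two orders of approximation. *)
Lemma poly_approx_ln_remainder d (phi : R -> R) (c : nat -> R) : 0 < d ->
  (forall u, 0 < u <= d -> 1 < phi u) -> c 0%N = 1 ->
  (forall n, poly_approx d phi (\poly_(k < n) c k) n) ->
  forall n, exists P, poly_approx d (fun u => (ln (phi u) - c 1%N * u) / u / u) P n.+1
    /\ P`_0 = c 2%N - c 1%N ^+ 2 / 2.
Proof.
move=> d0 phi1 c0 phic n.
pose v u := phi u - 1.
have vQ k : poly_approx d v (\poly_(i < k) c i - 1) k.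
  have := poly_approxD (phic k) (poly_approx_horner d (-1) k).
  by apply: poly_approx_ext => u _; rewrite hornerN hornerC.
have [K [K0 HK]] : exists C : R, 0 <= C /\ forall u, 0 < u <= d -> `|v u| <= C * u.
  have /poly_approxP[C [C0 HC]] := vQ 1%N.
  exists C; split=> // u ud; rewrite -[v u]subr0 -[X in _ * X]expr1.
  rewrite (_ : 0 = (\poly_(i < 1) c i - 1).[u]) ?HC//.
  by rewrite hornerD hornerN hornerC horner_poly big_ord1 c0 expr0 mulr1 subrr.
have ve u : 0 < u <= d -> 0 < v u <= K * d + 1.
  move=> /[dup] ud /andP[u0 ule]; have v0 : 0 < v u by rewrite subr_gt0 phi1.
  rewrite v0 -(gtr0_norm v0) (le_trans (HK u ud))// ler_wpDr// ler_wpM2l//.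
have Kv : exists K, forall u, 0 < u <= d -> v u <= K * u.
  by exists K => u ud; rewrite (le_trans (ler_norm _))// HK.
have Kd : 0 < K * d + 1 by rewrite ltr_wpDl// mulr_ge0// ltW.
pose W k := (\poly_(i < k) ln_coef i) \Po (\poly_(i < k) c i - 1).
have wW k : poly_approx d (fun u => ln (phi u)) (W k.+1) k.+1.
  have := poly_approx_comp ve Kv (poly_approx_ln1p k Kd) (vQ k.+1).
  by apply: poly_approx_ext => u _; rewrite /v addrCA subrr addr0.
pose T : {poly R} := (c 1%N)%:P * 'X + (c 2%N - c 1%N ^+ 2 / 2)%:P * 'X^2.
have wT : poly_approx d (fun u => ln (phi u)) T 3.
  apply: (@poly_approx_subst _ _ _ _ _
    ((- (c 1%N * c 2%N))%:P - (c 2%N ^+ 2 / 2)%:P * 'X) (wW 2%N)) => u.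
  rewrite /W /T horner_comp !hornerE !horner_poly !big_ord_recl !big_ord0 /= /bump /=.
  rewrite /ln_coef c0 !addn0 !add1n mulr0n invr0 mulr0 mul0r.
  by field.
have Wcoef k : (k < 3)%N -> (W n.+3)`_k = T`_k.
  apply: (@poly_approx_coef _ _ _ _ 3 d0 _ wT).
  by apply: poly_approx_le (wW n.+2); rewrite // ltW.
pose P := W n.+3 - (c 1%N)%:P * 'X.
have Pk k : (k < 3)%N -> P`_k = if k == 2%N then c 2%N - c 1%N ^+ 2 / 2 else 0.
  move=> k3; rewrite coefB Wcoef// /T !coefE.
  by case: k k3 => [|[|[|]]]//= _; rewrite ?mulr0 ?mulr1 ?addr0 ?subrr ?add0r ?subr0.
have P1 : poly_approx d (fun u => ln (phi u) - c 1%N * u) P n.+3.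
  have := poly_approxD (wW n.+2) (poly_approx_horner d (- ((c 1%N)%:P * 'X)) n.+3).
  by apply: poly_approx_ext => u _; rewrite !hornerE.
exists (drop_poly 1 (drop_poly 1 P)); split.
  apply: poly_approx_div; first by rewrite coef_drop_poly Pk.
  by apply: poly_approx_div P1; rewrite Pk.
by rewrite !coef_drop_poly Pk.
Qed.

End PolyApprox.

(** * Domination by a fixed function *)

Section Dominated.
Context {R : realType} {T : Type}.
Implicit Types (A : T -> Prop) (F B : T -> R).

Definition dominated A F B : Prop :=
  exists C : R, 0 <= C /\ forall x, A x -> `|F x| <= C * B x.

Lemma dominatedD A F G B : dominated A F B -> dominated A G B ->
  dominated A (fun x => F x + G x) B.
Proof.
move=> [C [C0 HC]] [D [D0 HD]]; exists (C + D); split=> [|x Ax]; first exact: addr_ge0.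
by rewrite (le_trans (ler_normD _ _))// mulrDl lerD ?HC ?HD.
Qed.

Lemma dominated_sum A n (F : nat -> T -> R) B : (forall x, A x -> 0 <= B x) ->
  (forall l, (l < n)%N -> dominated A (F l) B) ->
  dominated A (fun x => \sum_(l < n) F l x) B.
Proof.
move=> B0; elim: n => [|n IH] HF.
  by exists 0; split=> // x _; rewrite big_ord0 normr0 mul0r.
have [C [C0 HC]] := dominatedD (IH (fun l ln => HF l (ltnW ln))) (HF n (ltnSn n)).
by exists C; split=> // x Ax; rewrite big_ord_recr HC.
Qed.

Lemma dominated_le A F G B K : 0 <= K -> (forall x, A x -> `|F x| <= K * `|G x|) ->
  dominated A G B -> dominated A F B.
Proof.
move=> K0 FG [C [C0 HC]]; exists (K * C); split=> [|x Ax]; first exact: mulr_ge0.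
by rewrite (le_trans (FG x Ax))// -mulrA ler_wpM2l// HC.
Qed.

End Dominated.

(** * Pointwise expansion of a Laplace integrand *)

Section LaplacePointwise.
Context {R : realType}.

(** Half of the decay rate pays for any power. *)
Lemma exprn_expR_le (a : R) n : 0 < a ->
  exists K : R, 0 <= K /\ forall y, 0 <= y ->
    y ^+ n * expR (- (a / 2 * y)) <= K * expR (- (a / 4 * y)).
Proof.
move=> a0; have a40 : 0 < a / 4 by rewrite divr_gt0.
have half y : a / 2 * y = a / 4 * y + a / 4 * y by field.
exists ((a / 4) ^- n * n`!%:R); split=> [|y y0].
  by rewrite mulr_ge0// invr_ge0 exprn_ge0// ltW.
rewrite half opprD expRD mulrA ler_wpM2r ?expR_ge0//.
rewrite expRN ler_pdivrMr ?expR_gt0// -[leRHS]mulrA ler_pdivlMl ?exprn_gt0// -exprMn.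
have z0 : 0 <= a / 4 * y by rewrite mulr_ge0// ltW.
case: n => [|n]; first by rewrite expr0 mul1r (le_trans _ (expR_ge1Dx _)) ?lerDl.
rewrite -ler_pdivrMl ?ltr0n ?fact_gt0// mulrC.
by apply: le_trans (expR_ge1Dxn n z0); rewrite lerDr.
Qed.


(** With [y = m * u], a monomial [m^l u^e] is [m^(l - e) y^e]; the power of [y] is
    absorbed by half of the exponential decay. *)
Lemma dominated_monomial (a : R) N l e (A : R * R -> Prop) : 0 < a ->
  (forall x, A x -> 1 <= x.1 /\ 0 < x.2) -> (l + N <= e)%N ->
  dominated A (fun x => x.1 ^+ l * x.2 ^+ e * expR (- (a / 2 * (x.1 * x.2))))
    (fun x => expR (- (a / 4 * (x.1 * x.2))) / x.1 ^+ N).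
Proof.
move=> a0 HA lNe; have [K [K0 HK]] := exprn_expR_le e a0.
exists K; split=> // -[m u] /HA[/= m1 u0].
have m0 : 0 < m := lt_le_trans ltr01 m1.
rewrite ger0_norm; last by rewrite !mulr_ge0 ?expR_ge0 ?exprn_ge0// ltW.
rewrite [leRHS]mulrA ler_pdivlMr ?exprn_gt0//.
apply: le_trans (HK (m * u) _); last exact: mulr_ge0 (ltW m0) (ltW u0).
rewrite mulrAC ler_wpM2r ?expR_ge0// mulrAC -exprD exprMn ler_wpM2r ?exprn_ge0 ?(ltW u0)//.
exact: ler_weXn2l.
Qed.

(** Approximation of [exp (- m (a u + r u * u^2)) * f u], where [c l] is the expansion
    of [r^l f]. Both sums are cut at the same [N], which makes every term left out
    [O (m^(- N))]. *)
Definition laplace_partial (a : R) (c : nat -> nat -> R) N m u : R :=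
  expR (- (a * (m * u))) *
  \sum_(l < N) (- m) ^+ l / l`!%:R * (u ^+ (2 * l) * \sum_(k < N) c l k * u ^+ k).

(** The remainder has three parts. For [u <= d] there are the Taylor remainder of
    [exp (- m u^2 r u)], which is of degree [N] in [m] and [2 N] in [u], and the errors
    of the expansions of [r^l f]; the smallness of [|r u| u] keeps [exp (- a m u / 2)]
    available. For [u > d] only the approximation itself remains, and each of its terms
    gains the factor [(u / d)^N >= 1]. In all cases [u] has a power exceeding that of
    [m] by at least [N]. *)
Lemma laplace_pointwise (d a : R) (f r : R -> R) (c : nat -> nat -> R) N :
  0 < d -> 0 < a -> bounded_on d r -> bounded_on d f ->
  (forall u, 0 < u <= d -> `|r u| * u <= a / 2) ->
  (forall l, poly_approx d (fun u => r u ^+ l * f u) (\poly_(k < N) c l k) N) ->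
  dominated (fun x => 1 <= x.1 /\ 0 < x.2)
    (fun x => (if x.2 <= d then
                 expR (- (x.1 * (a * x.2 + r x.2 * x.2 ^+ 2))) * f x.2 else 0)
              - laplace_partial a c N x.1 x.2)
    (fun x => expR (- (a / 4 * (x.1 * x.2))) / x.1 ^+ N).
Proof.
move=> d0 a0 [Br [Br0 HBr]] [Bf [Bf0 HBf]] rua gapp.
pose B (x : R * R) := expR (- (a / 4 * (x.1 * x.2))) / x.1 ^+ N.
pose A1 (x : R * R) := 1 <= x.1 /\ 0 < x.2 <= d.
pose A2 (x : R * R) := 1 <= x.1 /\ d < x.2.
have A1P x : A1 x -> 1 <= x.1 /\ 0 < x.2 by move=> [? /andP[]].
have A2P x : A2 x -> 1 <= x.1 /\ 0 < x.2 by move=> [? /(lt_trans d0)].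
have B0 x : 1 <= x.1 /\ 0 < x.2 -> 0 <= B x.
  by move=> [x1 _]; rewrite divr_ge0 ?expR_ge0// exprn_ge0// (le_trans ler01).
have half m u : a * (m * u) = a / 2 * (m * u) + a / 2 * (m * u) by field.
have le_half m u : 1 <= m -> 0 < u -> expR (- (a * (m * u))) <= expR (- (a / 2 * (m * u))).
  move=> m1 u0; rewrite ler_expR lerN2 half lerDl mulr_ge0 ?divr_ge0 ?(ltW a0)//.
  by rewrite mulr_ge0 ?(ltW u0)// (le_trans ler01).
have dom1 : dominated A1 (fun x => expR (- (x.1 * (a * x.2 + r x.2 * x.2 ^+ 2))) * f x.2
              - laplace_partial a c N x.1 x.2) B.
  have T1 : dominated A1 (fun x => expR (- (a * (x.1 * x.2))) *
      (expR (- x.1 * (x.2 ^+ 2 * r x.2)) - expR_taylor N (- x.1 * (x.2 ^+ 2 * r x.2)))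
      * f x.2) B.
    have M := @dominated_monomial a N N (N + N)%N A1 a0 A1P (leqnn _).
    apply: (dominated_le (K := Br ^+ N * Bf) _ _ M).
      by rewrite mulr_ge0 ?exprn_ge0.
    move=> [m u] [/= m1 /[dup] ud /andP[u0 ule]].
    have m0 : 0 < m := lt_le_trans ltr01 m1.
    set z := - m * _.
    have nz : `|z| = m * (u ^+ 2 * `|r u|).
      by rewrite /z mulNr normrN normrM normrM normrX (gtr0_norm m0) (gtr0_norm u0).
    have z1 : `|z| <= a / 2 * (m * u).
      rewrite nz (_ : _ * _ = `|r u| * u * (m * u)); last by ring.
      by rewrite ler_wpM2r ?rua// mulr_ge0// ltW.
    have z2 : `|z| <= m * (u ^+ 2 * Br).
      by rewrite nz !ler_wpM2l ?exprn_ge0 ?(ltW m0) ?(ltW u0) ?HBr.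
    have zN : `|expR z - expR_taylor N z| <=
              (m * (u ^+ 2 * Br)) ^+ N * expR (a / 2 * (m * u)).
      rewrite (le_trans (expR_taylor_le _ _))// ler_pM ?exprn_ge0 ?expR_ge0 ?ler_expR//.
      by rewrite lerXn2r ?nnegrE// (le_trans _ z2).
    have eE : expR (- (a / 2 * (m * u))) =
              expR (- (a * (m * u))) * expR (a / 2 * (m * u)).
      by rewrite -expRD half; congr expR; ring.
    rewrite !normrM (ger0_norm (expR_ge0 _)) (ger0_norm (expR_ge0 _)) !normrX.
    rewrite (gtr0_norm m0) (gtr0_norm u0) eE.
    apply: (@le_trans _ _ (expR (- (a * (m * u))) *
      ((m * (u ^+ 2 * Br)) ^+ N * expR (a / 2 * (m * u))) * Bf)).
      by rewrite ler_pM ?mulr_ge0 ?expR_ge0 ?HBf// ler_wpM2l ?expR_ge0.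
    by rewrite !exprMn exprD le_eqVlt; apply/orP; left; apply/eqP; ring.
  have T2 : dominated A1 (fun x => \sum_(l < N) (expR (- (a * (x.1 * x.2))) *
      ((- x.1) ^+ l / l`!%:R * (x.2 ^+ (2 * l) *
        (r x.2 ^+ l * f x.2 - (\poly_(k < N) c l k).[x.2]))))) B.
    apply: (dominated_sum (F := fun l x => expR (- (a * (x.1 * x.2))) *
      ((- x.1) ^+ l / l`!%:R * (x.2 ^+ (2 * l) *
        (r x.2 ^+ l * f x.2 - (\poly_(k < N) c l k).[x.2])))))
      => [x /A1P /B0//|l lN].
    have [C [C0 HC]] := poly_approxP (gapp l).
    have lN2 : (l + N <= 2 * l + N)%N by rewrite leq_add2r leq_pmull.
    apply: (dominated_le (K := C) C0 _ (dominated_monomial a0 A1P lN2)).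
    move=> [m u] [/= m1 /[dup] ud /andP[u0 ule]].
    have m0 : 0 < m := lt_le_trans ltr01 m1.
    have l1 : `|(l`!%:R : R)^-1| <= 1.
      by rewrite normfV normr_nat invf_le1 ?ltr0n ?fact_gt0// ler1n fact_gt0.
    rewrite !normrM (ger0_norm (expR_ge0 _)) (ger0_norm (expR_ge0 _)) !normrX normrN.
    rewrite (gtr0_norm m0) (gtr0_norm u0).
    apply: (@le_trans _ _ (expR (- (a / 2 * (m * u))) *
      (m ^+ l * 1 * (u ^+ (2 * l) * (C * u ^+ N))))).
      rewrite ler_pM ?mulr_ge0 ?expR_ge0 ?exprn_ge0 ?(ltW m0) ?(ltW u0) ?le_half//.
      rewrite ler_pM ?mulr_ge0 ?exprn_ge0 ?(ltW m0) ?(ltW u0)//.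
        by rewrite ler_wpM2l ?exprn_ge0 ?(ltW m0).
      by rewrite ler_wpM2l ?exprn_ge0 ?(ltW u0)// HC.
    by rewrite exprD le_eqVlt; apply/orP; left; apply/eqP; ring.
  have [C [C0 HC]] := dominatedD T1 T2; exists C; split=> // x Ax.
  apply: le_trans (HC x Ax); rewrite le_eqVlt; apply/orP; left; apply/eqP.
  congr `|_|; case: x Ax => m u /= _; rewrite /laplace_partial.
  rewrite -mulr_sumr (_ : \sum_(l < N) (_ * (_ * (_ - _))) =
    expR_taylor N (- m * (u ^+ 2 * r u)) * f u - \sum_(l < N)
      (- m) ^+ l / l`!%:R * (u ^+ (2 * l) * \sum_(k < N) c l k * u ^+ k)); last first.
    rewrite /expR_taylor mulr_suml -sumrB; apply: eq_bigr => l _.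
    by rewrite horner_poly (exprMn l (- m)) (exprMn l (u ^+ 2)) -exprM; ring.
  have -> : expR (- (m * (a * u + r u * u ^+ 2))) =
            expR (- (a * (m * u))) * expR (- m * (u ^+ 2 * r u)).
    by rewrite -expRD; congr expR; ring.
  by ring.
have dom2 : dominated A2 (fun x => - laplace_partial a c N x.1 x.2) B.
  have T3 : dominated A2 (fun x => \sum_(l < N) \sum_(k < N)
      (expR (- (a * (x.1 * x.2))) * (- ((- x.1) ^+ l / l`!%:R)
         * (x.2 ^+ (2 * l) * (c l k * x.2 ^+ k))))) B.
    apply: (dominated_sum (F := fun l x => \sum_(k < N)
      (expR (- (a * (x.1 * x.2))) * (- ((- x.1) ^+ l / l`!%:R)
         * (x.2 ^+ (2 * l) * (c l k * x.2 ^+ k)))))) => [x /A2P /B0//|l lN].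
    apply: (dominated_sum (F := fun k x =>
      (expR (- (a * (x.1 * x.2))) * (- ((- x.1) ^+ l / l`!%:R)
         * (x.2 ^+ (2 * l) * (c l k * x.2 ^+ k)))))) => [x /A2P /B0//|k kN].
    have lN2 : (l + N <= 2 * l + k + N)%N.
      by rewrite leq_add2r (leq_trans _ (leq_addr _ _))// leq_pmull.
    have K0 : 0 <= `|c l k| / d ^+ N by rewrite divr_ge0// exprn_ge0// ltW.
    apply: (dominated_le K0 _ (dominated_monomial a0 A2P lN2)).
    move=> [m u] [/= m1 du].
    have m0 : 0 < m := lt_le_trans ltr01 m1.
    have u0 : 0 < u := lt_trans d0 du.
    have l1 : `|(l`!%:R : R)^-1| <= 1.
      by rewrite normfV normr_nat invf_le1 ?ltr0n ?fact_gt0// ler1n fact_gt0.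
    rewrite !(normrM, normrN) (ger0_norm (expR_ge0 _)) (ger0_norm (expR_ge0 _)) !normrX normrN.
    rewrite (gtr0_norm m0) (gtr0_norm u0).
    apply: (@le_trans _ _ (expR (- (a / 2 * (m * u))) *
      (m ^+ l * 1 * (u ^+ (2 * l) * (`|c l k| * u ^+ k))))).
      rewrite ler_pM ?mulr_ge0 ?expR_ge0 ?exprn_ge0 ?(ltW m0) ?(ltW u0) ?le_half//.
      rewrite ler_pM ?mulr_ge0 ?exprn_ge0 ?(ltW m0) ?(ltW u0)//.
      by rewrite ler_wpM2l ?exprn_ge0 ?(ltW m0).
    rewrite [leRHS](_ : _ = expR (- (a / 2 * (m * u))) *
      (m ^+ l * 1 * (u ^+ (2 * l) * (`|c l k| * u ^+ k))) * (u ^+ N / d ^+ N)); last first.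
      by rewrite !exprD; ring.
    rewrite ler_peMr ?mulr_ge0 ?expR_ge0 ?exprn_ge0 ?(ltW m0) ?(ltW u0)//.
    by rewrite ler_pdivlMr ?exprn_gt0// mul1r lerXn2r ?nnegrE ?(ltW d0) ?(ltW u0) ?(ltW du).
  have [C [C0 HC]] := T3; exists C; split=> // -[m u] Ax.
  apply: le_trans (HC (m, u) Ax); rewrite le_eqVlt; apply/orP; left; apply/eqP.
  congr `|_|; rewrite /laplace_partial /= -mulrN -sumrN mulr_sumr; apply: eq_bigr => l _.
  by rewrite -mulr_sumr -mulr_sumr -mulr_sumr mulNr.
have [C [C0 HC]] := dom1; have [D [D0 HD]] := dom2.
exists (C + D); split=> [|[m u] [/= m1 u0]]; first exact: addr_ge0.
have B0' := B0 (m, u) (conj m1 u0).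
case: (leP u d) => ud.
  have Ax : A1 (m, u) by split; [exact: m1|rewrite /= u0 ud].
  by have /= H := HC (m, u) Ax; rewrite (le_trans H)// mulrDl lerDl mulr_ge0.
have Ax : A2 (m, u) by split; [exact: m1|exact: ud].
by have /= H := HD (m, u) Ax; rewrite sub0r (le_trans H)// mulrDl lerDr mulr_ge0.
Qed.

End LaplacePointwise.

(** * Integrals over intervals and over the positive half-line *)

Section IntegralTools.
Context {R : realType}.
Local Notation mu := (@lebesgue_measure R).

(** Monotone convergence along an exhaustion by compact intervals, which avoids the
    endpoints where an integrand or a change of variables is singular. *)
Lemma integral_0y_cvg (f : R -> R) (a b : nat -> R) :
  measurable_fun [set: R] f -> (forall x, 0 < x -> 0 <= f x) ->
  (forall n, 0 < a n) -> nonincreasing_seq a -> nondecreasing_seq b ->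
  (forall x, 0 < x -> exists n, a n <= x <= b n) ->
  (\int[mu]_(x in `[a n, b n]) (f x)%:E @[n --> \oo] -->
   \int[mu]_(x in `]0%R, +oo[) (f x)%:E)%E.
Proof.
move=> mf f0 a0 na nb ab.
have -> : `]0%R, +oo[%classic = \bigcup_n `[a n, b n]%classic.
  apply/seteqP; split => x /=; rewrite in_itv/= ?andbT.
    by move=> /ab[n abn]; exists n => //=; rewrite in_itv.
  by move=> [n _ /=]; rewrite in_itv/= => /andP[ax _]; exact: lt_le_trans (a0 n) ax.
apply: ge0_nondecreasing_set_cvg_integral.
- move=> n m nm; rewrite subsetEset => x /=; rewrite !in_itv/= => /andP[ax xb].
  by rewrite (le_trans (na _ _ nm))// (le_trans xb)// nb.
- by move=> n.
- by move=> n; apply/measurable_EFinP; exact: measurable_funTS.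
- move=> n x /=; rewrite in_itv/= => /andP[ax _]; rewrite lee_fin f0//.
  exact: lt_le_trans ax.
Qed.

(** Substitution where the derivative of [F] is known in the open interval only, as for
    an integral with fixed lower bound; at the endpoints [f] stands for its limits. *)
Lemma substitution_within (F f G : R -> R) a b : a < b ->
  {in `[a, b] &, {homo F : x y / x < y}} ->
  (forall x, a < x < b -> is_derive x 1 F (f x)) ->
  {within `[a, b], continuous F} -> {within `[a, b], continuous f} ->
  {within `[F a, F b], continuous G} ->
  (\int[mu]_(x in `[F a, F b]) (G x)%:E =
   \int[mu]_(x in `[a, b]) (G (F x) * f x)%:E)%E.
Proof.
move=> ab Fmono Fd Fc fc Gc.
have /(continuous_within_itvP _ ab)[fc1 fc2 fc3] := fc.
have /(continuous_within_itvP _ ab)[Fc1 Fc2 Fc3] := Fc.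
have FaFb : F a < F b by apply: Fmono; rewrite // in_itv/= lexx ltW.
have /(continuous_within_itvP _ FaFb)[Gc1 Gc2 Gc3] := Gc.
have Ff : {in `]a, b[, F^`()%classic =1 f}.
  move=> x; rewrite in_itv/= => xab; rewrite derive1E.
  by have := Fd x xab => Fdx; exact: derive_val.
have nearFf x : x \in `]a, b[ -> {near x, f =1 F^`()%classic}.
  by move=> xab; near=> y; apply/esym/Ff; near: y; exact: near_in_itvoo.
rewrite integration_by_substitution_increasing//.
- have Gf : measurable_fun `]a, b[ (fun x => G (F x) * f x).
    apply: open_continuous_measurable_fun; first exact: interval_open.
    move=> x; rewrite inE /= => xab; apply: cvgM; last exact: fc1.
    apply: (@continuous_comp _ _ _ F G); first exact: Fc1.
    apply: Gc1; move: xab; rewrite !in_itv/= => /andP[ax xb].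
    by rewrite !Fmono// in_itv/= ?lexx ?(ltW ab) ?(ltW ax) ?(ltW xb).
  rewrite !(@integral_itv_bndoo _ a b _ true false).
  + by apply: eq_integral => x; rewrite inE/= => xab; rewrite mulrfctE Ff.
  + exact/measurable_EFinP.
  + apply/measurable_EFinP; apply: eq_measurable_fun Gf => x; rewrite inE/= => xab.
    by rewrite mulrfctE Ff.
- exact: ltW.
- move=> x xab; apply: (cvg_trans (near_eq_cvg (nearFf x xab))).
  by rewrite Ff//; exact: fc1.
- apply/cvg_ex; exists (f a); apply: cvg_trans fc2; apply: near_eq_cvg.
  by near=> y; apply/esym/Ff; rewrite in_itv/=; apply/andP; split.
- apply/cvg_ex; exists (f b); apply: cvg_trans fc3; apply: near_eq_cvg.
  by near=> y; apply/esym/Ff; rewrite in_itv/=; apply/andP; split.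
- split=> // x; rewrite in_itv/= => xab.
  by have := Fd x xab => Fdx; exact: ex_derive.
Unshelve. all: end_near.
Qed.

Lemma is_derive_continuous (F : R -> R) (x df : R) :
  is_derive x (1 : R) F df -> {for x, continuous F}.
Proof.
by move=> D; apply/differentiable_continuous/derivable1_diffP; exact: ex_derive.
Qed.

Lemma within_itv_continuous_comp (g h : R -> R) (a b : R) : a < b ->
  {within `[a, b], continuous g} -> (forall x, a <= x <= b -> {for g x, continuous h}) ->
  {within `[a, b], continuous (fun x => h (g x))}.
Proof.
move=> ab /(continuous_within_itvP _ ab)[g1 g2 g3] hc.
apply/(continuous_within_itvP _ ab); split.
- move=> x xab; apply: continuous_comp; first exact: g1.
  by apply: hc; move: xab; rewrite in_itv/= => /andP[/ltW-> /ltW->].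
- apply: (cvg_comp g h g2); apply: hc; rewrite lexx; exact: ltW.
- apply: (cvg_comp g h g3); apply: hc; rewrite lexx andbT; exact: ltW.
Qed.

Lemma powR_within_continuous (q b : R) : 0 < q -> 0 < b ->
  {within `[0, b], continuous (fun t : R => t `^ q)}.
Proof.
move=> q0 b0; apply/(continuous_within_itvP _ b0); split.
- move=> x; rewrite in_itv/= => /andP[x0 _].
  exact: (is_derive_continuous (is_derive1_powR q x0)).
- by rewrite powR0 ?gt_eqF//; exact: powR_cvg0.
- apply: cvg_at_left_filter.
  exact: (is_derive_continuous (is_derive1_powR q b0)).
Qed.

Lemma derivable_within_itv (F f : R -> R) (a b : R) :
  (forall x, a <= x <= b -> is_derive x 1 F (f x)) -> {within `[a, b], continuous F}.
Proof.
move=> Fd; apply: derivable_within_continuous => x; rewrite in_itv/= => xab.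
by have := Fd x xab => Fdx; exact: ex_derive.
Qed.

Lemma integrable_0y_bounded (f : R -> R) (C e : R) : 0 < e ->
  measurable_fun [set: R] f -> (forall x, 0 < x -> `|f x| <= C * expR (- (e * x))) ->
  mu.-integrable `]0, +oo[ (EFin \o f).
Proof.
move=> e0 mf fC.
have C0 : 0 <= C.
  have := fC 1 ltr01; move/(le_trans (normr_ge0 _)).
  by rewrite pmulr_lge0// expR_gt0.
have Hexp : mu.-integrable `]0, +oo[
    (fun x => (C / e)%:E * (exponential_pdf e x)%:E)%E.
  apply: integrableZl => //.
  by apply: integrableS (integrable_exponential_pdf e0).
apply: le_integrable Hexp => //.
  by apply/measurable_EFinP; exact: measurable_funTS.
move=> x /=; rewrite in_itv/= andbT => x0.
rewrite lee_fin (le_trans (fC x x0))// exponential_pdfE ?(ltW x0)//.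
rewrite mulrA divfK ?gt_eqF// mulNr.
exact: ler_norm.
Qed.

End IntegralTools.

(** * Moments of a stretched exponential and the Gamma function *)

Section Moments.
Context {R : realType}.
Local Notation mu := (@lebesgue_measure R).
Implicit Types (q lam s : R) (k : nat).

Definition moment_fun q lam k s : R := (s `^ q) ^+ k * expR (- (lam * s `^ q)).

Definition moment q lam k : R := \int[mu]_(s in `]0, +oo[) moment_fun q lam k s.

Lemma measurable_moment_fun q lam k : measurable_fun [set: R] (moment_fun q lam k).
Proof.
apply: measurable_funM.
  by apply: measurable_funX; exact: measurable_powR.
apply: measurableT_comp => //.
apply: measurableT_comp => //; apply: measurable_funM => //.
Qed.

Lemma moment_fun_ge0 q lam k s : 0 <= moment_fun q lam k s.
Proof. by rewrite mulr_ge0 ?expR_ge0// exprn_ge0// powR_ge0. Qed.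

Lemma integrable_moment q lam k : 1 < q -> 0 < lam ->
  mu.-integrable `]0, +oo[ (EFin \o moment_fun q lam k).
Proof.
move=> q1 l0; have [K [K0 HK]] := exprn_expR_le k (mulr_gt0 (ltr0Sn R 1) l0).
have l20 : 0 < lam / 2 by rewrite divr_gt0.
apply: (@integrable_0y_bounded _ _ (K * expR (lam / 2)) (lam / 2)) => //.
  exact: measurable_moment_fun.
move=> x x0; rewrite ger0_norm ?moment_fun_ge0// /moment_fun.
have := HK (x `^ q) (powR_ge0 _ _).
have -> : 2 * lam / 2 * x `^ q = lam * x `^ q by field.
have -> : 2 * lam / 4 * x `^ q = lam / 2 * x `^ q by field.
move/le_trans; apply; rewrite -[leRHS]mulrA ler_wpM2l// -expRD ler_expR.
rewrite -[X in _ <= X + _]mulr1 -mulrN -mulrN -mulrDr ler_wpM2l ?(ltW l20)//.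
have [x1|x1] := leP 1 x.
  by rewrite ler_wpDl// lerN2 le1r_powR// ltW.
by rewrite (@le_trans _ _ 0)// ?oppr_le0 ?powR_ge0// subr_ge0 ltW.
Qed.

(** The intervals [[exh_lo n, exh_hi n]] exhaust the positive half-line; the offset [2]
    keeps the first of them nondegenerate. *)
Definition exh_lo n : R := n.+2%:R^-1.
Definition exh_hi n : R := n.+2%:R.

Lemma exh_lo_gt0 n : 0 < exh_lo n. Proof. by rewrite invr_gt0. Qed.

Lemma exh_lo_lt_hi n : exh_lo n < exh_hi n.
Proof.
rewrite /exh_lo /exh_hi (@lt_trans _ _ 1)// ?ltr1n//.
by rewrite invf_lt1// ltr1n.
Qed.

Lemma exh_lo_noninc : nonincreasing_seq exh_lo.
Proof. by move=> n m nm; rewrite lef_pV2 ?posrE// ler_nat. Qed.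

Lemma exh_hi_nondec : nondecreasing_seq exh_hi.
Proof. by move=> n m nm; rewrite ler_nat. Qed.

Lemma exh_exhausts (y : R) : 0 < y -> exists n, exh_lo n <= y <= exh_hi n.
Proof.
move=> y0; have y0' : 0 < y^-1 by rewrite invr_gt0.
exists (Num.bound (y + y^-1)).
have : y + y^-1 < (Num.bound (y + y^-1))%:R by rewrite archi_boundP// addr_ge0 ?ltW.
set n := Num.bound _ => yn.
have n2 : n%:R <= n.+2%:R :> R by rewrite ler_nat -addn2 leq_addr.
apply/andP; split.
  rewrite /exh_lo invf_ple ?posrE// (le_trans _ n2)// (le_trans _ (ltW yn))//.
  by rewrite lerDr ltW.
by rewrite /exh_hi (le_trans _ n2)// (le_trans _ (ltW yn))// lerDl ltW.
Qed.

Lemma is_derive_scaled_powR q lam s : 0 < s ->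
  is_derive s (1 : R) (fun s : R => lam * s `^ q) (lam * (q * s `^ (q - 1))).
Proof.
move=> s0; have H := is_derive1_powR q s0.
exact: (is_deriveZ lam H).
Qed.

Lemma is_derive_expRN (s : R) : is_derive s (1 : R) (fun s : R => expR (- s)) (- expR (- s)).
Proof.
have := is_derive1_comp (is_derive_expR (- s)) (is_deriveNid s 1).
by move/trigger_derive; apply; rewrite mulrN1.
Qed.

(** The change of variables [t = lam s^q] turns the Euler integral into a moment
    of [exp (- lam s^q)]. *)
Lemma Gamma_moment q lam k : 1 < q -> 0 < lam ->
  Gamma (k%:R + q^-1) = q * lam `^ (k%:R + q^-1) * moment q lam k.
Proof.
move=> q1 l0; have q0 : 0 < q := lt_trans ltr01 q1.
set z := k%:R + q^-1.
pose G (t : R) := t `^ (z - 1) * expR (- t).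
pose F (s : R) := lam * s `^ q.
pose c := q * lam `^ z.
have Fd (s : R) : 0 < s -> is_derive s (1 : R) F (lam * (q * s `^ (q - 1))).
  exact: is_derive_scaled_powR.
have F0 (s : R) : 0 < s -> 0 < F s by move=> s0; rewrite mulr_gt0 ?powR_gt0.
have Fmono (x y : R) : 0 <= x -> x < y -> F x < F y.
  move=> x0 xy; rewrite ltr_pM2l// gt0_ltr_powR ?nnegrE// ltW//.
  exact: le_lt_trans xy.
have Fmono' (x y : R) : 0 <= x -> x <= y -> F x <= F y.
  move=> x0; rewrite le_eqVlt => /predU1P[->//|xy].
  by rewrite ltW// Fmono.
have eqn n : (\int[mu]_(x in `[F (exh_lo n), F (exh_hi n)]) (G x)%:E =
   \int[mu]_(s in `[exh_lo n, exh_hi n]) (c * moment_fun q lam k s)%:E)%E.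
  etransitivity; first apply: (@substitution_within R F (fun s => lam * (q * s `^ (q - 1))) G).
  - exact: exh_lo_lt_hi.
  - move=> x y; rewrite !in_itv/= => /andP[ax _] _; apply: Fmono.
    by rewrite (le_trans _ ax)// ltW// exh_lo_gt0.
  - by move=> x /andP[ax _]; apply: Fd; exact: lt_trans (exh_lo_gt0 n) ax.
  - apply: derivable_within_itv => x /andP[ax _]; apply: Fd.
    exact: lt_le_trans (exh_lo_gt0 n) ax.
  - rewrite (_ : (fun s => _) = (fun s => lam * q * s `^ (q - 1))); last first.
      by apply/funext => s; rewrite mulrA.
    apply: derivable_within_itv => x /andP[ax _]; apply: is_derive_scaled_powR.
    exact: lt_le_trans (exh_lo_gt0 n) ax.
  - apply: derivable_within_itv => x /andP[ax _].
    have x0 : 0 < x := lt_le_trans (F0 _ (exh_lo_gt0 n)) ax.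
    have := is_derive1_powR (z - 1) x0; have := is_derive_expRN x => D1 D2.
    exact: is_deriveM.
  - apply: eq_integral => x; rewrite inE/= in_itv/= => /andP[ax xb]; congr EFin.
    have x0 : 0 < x := lt_le_trans (exh_lo_gt0 n) ax.
    have xk : (x `^ q) ^+ k = (x `^ q) `^ (z - 1) * x `^ (q - 1).
      rewrite -powR_mulrn ?powR_ge0// -!powRrM -powRD; last by rewrite [x == 0]gt_eqF ?implybT.
      by congr (_ `^ _); rewrite /z; field; rewrite gt_eqF.
    rewrite /G /F /c /moment_fun powRM ?powR_ge0 ?(ltW l0)// xk.
    rewrite -[in RHS](mulr_powRB1 (ltW l0) (_ : 0 < z)); first by ring.
    by rewrite /z ltr_wpDl// invr_gt0.
have limG : (\int[mu]_(x in `[F (exh_lo n), F (exh_hi n)]) (G x)%:E @[n --> \oo] -->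
   \int[mu]_(x in `]0%R, +oo[) (G x)%:E)%E.
  apply: (@integral_0y_cvg _ G (F \o exh_lo) (F \o exh_hi)).
  - apply: measurable_funM; first exact: measurable_powR.
    by apply: measurableT_comp.
  - by move=> x x0; rewrite mulr_ge0 ?powR_ge0 ?expR_ge0.
  - by move=> n; apply: F0; exact: exh_lo_gt0.
  - move=> n m nm /=; apply: Fmono'; first exact/ltW/exh_lo_gt0.
    exact: exh_lo_noninc.
  - move=> n m nm /=; apply: Fmono'; first exact: ler0n.
    exact: exh_hi_nondec.
  - move=> x x0; pose y := (x / lam) `^ q^-1.
    have xl : 0 < x / lam by rewrite divr_gt0.
    have [|n /andP[ay yb]] := @exh_exhausts y; first by rewrite powR_gt0.
    have -> : x = F y.
      by rewrite /F /y -powRrM mulVf ?gt_eqF// powRr1 ?(ltW xl)// mulrC divfK ?gt_eqF.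
    exists n; rewrite /= !Fmono' ?powR_ge0//.
    exact/ltW/exh_lo_gt0.
have limE : (\int[mu]_(x in `[exh_lo n, exh_hi n]) (c * moment_fun q lam k x)%:E @[n --> \oo] -->
   \int[mu]_(x in `]0%R, +oo[) (c * moment_fun q lam k x)%:E)%E.
  apply: (@integral_0y_cvg _ (fun x => c * moment_fun q lam k x)).
  - by apply: measurable_funM => //; exact: measurable_moment_fun.
  - by move=> x _; rewrite mulr_ge0 ?moment_fun_ge0// mulr_ge0 ?powR_ge0// ltW.
  - exact: exh_lo_gt0.
  - exact: exh_lo_noninc.
  - exact: exh_hi_nondec.
  - exact: exh_exhausts.
rewrite /Gamma /moment.
transitivity (\int[mu]_(x in `]0%R, +oo[) (c * moment_fun q lam k x)).
  rewrite -(funext eqn) in limE.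
  by congr fine; exact: (cvg_unique _ limG limE).
by rewrite RintegralZl//; exact: integrable_moment.
Qed.

Lemma subset_exh n : `[exh_lo n, exh_hi n] `<=` `]0, +oo[%classic.
Proof.
move=> x /=; rewrite !in_itv/= andbT => /andP[ax _].
exact: lt_le_trans (exh_lo_gt0 n) ax.
Qed.

Lemma momentE q lam k : 1 < q -> 0 < lam ->
  (\int[mu]_(s in `]0%R, +oo[) (moment_fun q lam k s)%:E = (moment q lam k)%:E)%E.
Proof.
move=> q1 l0; rewrite /moment /Rintegral fineK//.
by apply: integrable_fin_num => //; exact: integrable_moment.
Qed.

Lemma moment_cvg q lam k : 1 < q -> 0 < lam ->
  \int[mu]_(s in `[exh_lo n, exh_hi n]) moment_fun q lam k s @[n --> \oo] -->
  moment q lam k.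
Proof.
move=> q1 l0; apply: fine_cvg; rewrite -momentE//.
apply: integral_0y_cvg.
- exact: measurable_moment_fun.
- by move=> x _; exact: moment_fun_ge0.
- exact: exh_lo_gt0.
- exact: exh_lo_noninc.
- exact: exh_hi_nondec.
- exact: exh_exhausts.
Qed.

(** On [[1, 2]] the integrand is bounded below by a positive constant. *)
Lemma moment_gt0 q lam k : 1 < q -> 0 < lam -> 0 < moment q lam k.
Proof.
move=> q1 l0; have q0 : 0 < q := lt_trans ltr01 q1.
pose c := expR (- (lam * 2 `^ q)).
have c0 : 0 < c by exact: expR_gt0.
rewrite -lte_fin -momentE//; apply: (@lt_le_trans _ _ (\int[mu]_(s in `[1%R, 2%R]) c%:E)%E).
  rewrite integral_cst//= lebesgue_measure_itv/= lte_fin ltr1n /=.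
  by rewrite -EFinD -EFinM lte_fin mulr_gt0// subr_gt0 ltr1n.
apply: (@le_trans _ _ (\int[mu]_(s in `[1%R, 2%R]) (moment_fun q lam k s)%:E)%E).
  apply: ge0_le_integral => //.
  - by move=> x _; rewrite lee_fin ltW.
  - by apply/measurable_EFinP; apply: measurable_funTS; exact: measurable_moment_fun.
  - move=> x /=; rewrite in_itv/= => /andP[x1 x2]; rewrite lee_fin /moment_fun.
    have x0 : 0 <= x by rewrite (le_trans ler01).
    rewrite -[leLHS]mul1r ler_pM ?expR_ge0//.
      by rewrite exprn_ege1// (le_trans x1)// le1r_powR// ltW.
    by rewrite ler_expR lerN2 ler_wpM2l ?(ltW l0)// ge0_ler_powR ?nnegrE ?(ltW q0).
apply: ge0_subset_integral => //.
- by apply/measurable_EFinP; apply: measurable_funTS; exact: measurable_moment_fun.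
- by move=> x _; rewrite lee_fin moment_fun_ge0.
- move=> x /=; rewrite !in_itv/= andbT => /andP[x1 _].
  exact: lt_le_trans ltr01 x1.
Qed.

Lemma is_derive_id_moment_fun q k (s : R) : 0 < s ->
  is_derive s (1 : R) (fun s : R => s * moment_fun q 1 k s)
    ((k%:R * q + 1) * moment_fun q 1 k s - q * moment_fun q 1 k.+1 s).
Proof.
move=> s0; have D1 := is_derive1_powR q s0.
have mE j t : moment_fun q 1 j t = t `^ (q * j%:R) * expR (- (t `^ q)).
  by rewrite /moment_fun mul1r powRrM powR_mulrn// powR_ge0.
have D2 := is_derive1_powR (q * k%:R) s0.
have D3 := @is_derive1_comp R (fun t => expR (- t)) (fun t => t `^ q) s _ _
  (is_derive_expRN (s `^ q)) D1.
have D4 := is_deriveM (is_derive_id s 1) (is_deriveM D2 D3).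
have -> : (fun t : R => t * moment_fun q 1 k t) =
  id * ((fun t : R => t `^ (q * k%:R)) * ((fun t : R => expR (- t)) \o (fun t : R => t `^ q))).
  by apply/funext => t; rewrite mE.
apply: (trigger_derive D4).
have pred r : s * s `^ (r - 1) = s `^ r.
  by rewrite -{1}(powRr1 (ltW s0)) -powRD ?(gt_eqF s0) ?implybT// addrCA subrr addr0.
have qk : s `^ (q * k.+1%:R) = s `^ (q * k%:R) * s `^ q.
  by rewrite -powRD ?(gt_eqF s0) ?implybT//; congr (_ `^ _); rewrite -natr1; ring.
rewrite !mE qk mulrfctE /GRing.scale /=.
set e := expR _; rewrite -(pred q) -(pred (q * k%:R)).
by ring.
Qed.

Lemma continuous_moment_fun q lam k (s : R) : 0 < s -> {for s, continuous (moment_fun q lam k)}.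
Proof.
move=> s0; have c1 : {for s, continuous (fun s : R => s `^ q)}.
  have D1 := is_derive1_powR q s0.
  by apply/differentiable_continuous/derivable1_diffP; exact: ex_derive.
apply: cvgM.
  exact: (continuous_comp c1 (@exprn_continuous _ k _)).
apply: (@continuous_comp _ _ _ (fun s => - (lam * s `^ q)) expR).
  by apply: cvgN; apply: cvgMl_tmp; exact: c1.
exact: continuous_expR.
Qed.

(** Integration by parts for the moments: the integral of the derivative of
    [s (s^q)^k exp (- s^q)] over the whole half-line vanishes. *)
Lemma moment_rec q k : 1 < q ->
  (k%:R * q + 1) * moment q 1 k = q * moment q 1 k.+1.
Proof.
move=> q1; have q0 : 0 < q := lt_trans ltr01 q1.
pose h s := s * moment_fun q 1 k s.
pose g s := (k%:R * q + 1) * moment_fun q 1 k s - q * moment_fun q 1 k.+1 s.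
pose I j n := \int[mu]_(s in `[exh_lo n, exh_hi n]) moment_fun q 1 j s.
have xpos n x : x \in `[exh_lo n, exh_hi n] -> 0 < x.
  by rewrite in_itv/= => /andP[ax _]; exact: lt_le_trans (exh_lo_gt0 n) ax.
have hcont s : 0 < s -> {for s, continuous h}.
  move=> s0; have D := is_derive_id_moment_fun q k s0.
  by apply/differentiable_continuous/derivable1_diffP; exact: ex_derive.
have FTC n : (k%:R * q + 1) * I k n - q * I k.+1 n = h (exh_hi n) - h (exh_lo n).
  have ig j : mu.-integrable `[exh_lo n, exh_hi n] (EFin \o moment_fun q 1 j).
    by apply: integrableS (integrable_moment j q1 ltr01) => //; exact: subset_exh.
  rewrite /I -!RintegralZl// -RintegralB//; last 2 first.
  - exact: (integrableZl _ _ (ig k)).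
  - exact: (integrableZl _ _ (ig k.+1)).
  rewrite /Rintegral.
  rewrite (@continuous_FTC2 _ g h)//.
  - exact: exh_lo_lt_hi.
  - apply: continuous_in_subspaceT => x; rewrite inE/= => xab; have x0 := xpos n x xab.
    by apply: cvgB; apply: cvgMl_tmp; exact: continuous_moment_fun.
  - split.
    + move=> x xab; have D := is_derive_id_moment_fun q k (xpos n x (subset_itv_oo_cc xab)).
      exact: ex_derive.
    + by apply: cvg_at_right_filter; apply: hcont; exact: exh_lo_gt0.
    + by apply: cvg_at_left_filter; apply: hcont; rewrite ltr0n.
  - move=> x xab; have D := is_derive_id_moment_fun q k (xpos n x (subset_itv_oo_cc xab)).
    by rewrite derive1E; exact: derive_val.
have [K HK] : exists K, forall n, `|h (exh_hi n) - h (exh_lo n)| <= K * exh_lo n.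
  have [K0 [K00 HK0]] := exprn_expR_le k (ltr0Sn R 1).
  have [K2 [K20 HK2]] := exprn_expR_le k.+2 (ltr0Sn R 1).
  have bnd j K (y : R) : 0 <= y -> 0 <= K ->
      (forall y, 0 <= y -> y ^+ j * expR (- (2 / 2 * y)) <= K * expR (- (2 / 4 * y))) ->
      y ^+ j * expR (- (1 * y)) <= K.
    move=> y0 Kp /(_ y y0); rewrite divff// => /le_trans; apply.
    by rewrite ler_piMr// -expR0 ler_expR oppr_le0 mulr_ge0 ?divr_ge0.
  exists (K2 + K0) => n; rewrite (le_trans (ler_normB _ _))// mulrDl lerD//.
    rewrite /h ger0_norm; last by rewrite mulr_ge0 ?moment_fun_ge0 ?ler0n.
    have s1 : 1 <= exh_hi n by rewrite /exh_hi ler1n.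
    have s0 := lt_le_trans ltr01 s1.
    rewrite /exh_lo -/(exh_hi n) ler_pdivlMr// /moment_fun.
    (* At the upper end [s <= s^q] trades [s^2] for two more powers of [s^q]. *)
    set s := exh_hi n in s1 s0 *; set y := s `^ q.
    have sy : s <= y by rewrite /y le1r_powR// ltW.
    have y0 : 0 <= y by exact: powR_ge0.
    apply: le_trans (bnd _ _ _ y0 K20 HK2).
    rewrite (_ : _ * _ * s = s ^+ 2 * (y ^+ k * expR (- (1 * y)))); last by ring.
    rewrite [leRHS](_ : _ = y ^+ 2 * (y ^+ k * expR (- (1 * y)))); last first.
      by rewrite !exprS expr0; ring.
    by rewrite ler_wpM2r ?mulr_ge0 ?expR_ge0 ?exprn_ge0// lerXn2r ?nnegrE ?(ltW s0).
  rewrite /h ger0_norm; last by rewrite mulr_ge0 ?moment_fun_ge0 ?(ltW (exh_lo_gt0 n)).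
  rewrite mulrC ler_wpM2r ?(ltW (exh_lo_gt0 n))//.
  exact: bnd (powR_ge0 _ _) K00 HK0.
have lim1 : (k%:R * q + 1) * I k n - q * I k.+1 n @[n --> \oo] -->
   (k%:R * q + 1) * moment q 1 k - q * moment q 1 k.+1.
  by apply: cvgB; apply: cvgMl_tmp; exact: moment_cvg.
have lim0 : (k%:R * q + 1) * I k n - q * I k.+1 n @[n --> \oo] --> (0 : R).
  apply: norm_cvg0; apply: (@squeeze_cvgr _ _ _ _ (cst 0) (fun n => `|K| * harmonic n)).
  - near=> n; rewrite normr_ge0 FTC (le_trans (HK n))//.
    rewrite (le_trans (ler_norm _))// normrM ler_wpM2l// (gtr0_norm (exh_lo_gt0 n)).
    by rewrite /exh_lo lef_pV2 ?posrE// ler_nat.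
  - exact: cvg_cst.
  - by rewrite -[X in _ --> X](mulr0 `|K|); apply: cvgMl_tmp; exact: cvg_harmonic.
apply/eqP; rewrite -subr_eq0; apply/eqP.
exact: (cvg_unique _ lim1 lim0).
Unshelve. all: by end_near.
Qed.

Lemma Gamma_gt0 q k : 1 < q -> 0 < Gamma (k%:R + q^-1).
Proof.
move=> q1; have q0 : 0 < q := lt_trans ltr01 q1.
by rewrite (@Gamma_moment q 1 k)// powR1 mulr1 mulr_gt0// moment_gt0.
Qed.

Lemma Gamma_succ q k : 1 < q ->
  Gamma (k.+1%:R + q^-1) = (k%:R + q^-1) * Gamma (k%:R + q^-1).
Proof.
move=> q1; have q0 : 0 < q := lt_trans ltr01 q1.
rewrite !(@Gamma_moment q 1)// !powR1 !mulr1 -moment_rec//.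
by field; rewrite gt_eqF.
Qed.

Lemma moment_scale q lam k : 1 < q -> 0 < lam ->
  moment q lam k = Gamma (k%:R + q^-1) / q / lam ^+ k * lam `^ (- q^-1).
Proof.
move=> q1 l0; have q0 : 0 < q := lt_trans ltr01 q1.
rewrite (@Gamma_moment q lam k)// powRD ?(gt_eqF l0) ?implybT// powR_mulrn ?(ltW l0)//.
rewrite powRN; have lk : lam ^+ k != 0 by rewrite gt_eqF// exprn_gt0.
have lq : lam `^ q^-1 != 0 by rewrite gt_eqF// powR_gt0.
by field; rewrite lk lq gt_eqF.
Qed.

End Moments.

(** * Term-by-term integration of the Laplace integrand *)

Section LaplaceIntegral.
Context {R : realType}.
Local Notation mu := (@lebesgue_measure R).

Lemma integrable_Rintegral_sum (D : set R) n (F : nat -> R -> R) : measurable D ->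
  (forall i, (i < n)%N -> mu.-integrable D (EFin \o F i)) ->
  mu.-integrable D (EFin \o (fun x => \sum_(i < n) F i x)) /\
  \int[mu]_(x in D) (\sum_(i < n) F i x) = \sum_(i < n) \int[mu]_(x in D) F i x.
Proof.
move=> mD; elim: n => [|n IH] iF.
  rewrite big_ord0; split.
    apply: eq_integrable (integrable0 mu D) => // x _ /=.
    by rewrite big_ord0.
  rewrite (_ : (fun x => _) = cst 0) ?Rintegral_cst ?mul0r//.
  by apply/funext => x; rewrite big_ord0.
have [i1 E1] := IH (fun i ni => iF i (ltnW ni)).
have i2 := iF n (ltnSn n).
have eqF : (fun x => \sum_(i < n.+1) F i x) = (fun x => \sum_(i < n) F i x + F n x).
  by apply/funext => x; rewrite big_ord_recr.
rewrite eqF big_ord_recr -E1; split; last by rewrite RintegralD.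
exact: (integrableD _ i1 i2).
Qed.

(** Result of integrating [laplace_partial] against [ds] at [u = s^q], [m = 1 / x], and
    multiplying by [m^(1/q)]. *)
Definition laplace_poly (q a : R) (c : nat -> nat -> R) N : {poly R} :=
  \sum_(l < N) \sum_(k < N)
    ((-1) ^+ l / l`!%:R * c l k * (Gamma ((2 * l + k)%:R + q^-1) / q
       / a ^+ (2 * l + k) * a `^ (- q^-1))) *: 'X^(l + k).

(** A bound [C m^(- N) exp (- a m s^q / 4)] on the error of the integrand has integral
    [O (m^(- N - 1/q))], the moment of order [0]; the factor [m^(1/q)] restores the
    order [N]. *)
Lemma laplace_integral (q a : R) (c : nat -> nat -> R) N (h : R -> R -> R) :
  1 < q -> 0 < a -> (forall m, 1 <= m -> measurable_fun (`]0, +oo[ : set R) (h m)) ->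
  (exists C, 0 <= C /\ forall m s, 1 <= m -> 0 < s ->
     `|h m s - laplace_partial a c N m (s `^ q)| <=
     C * (expR (- (a / 4 * (m * s `^ q))) / m ^+ N)) ->
  (forall m, 1 <= m -> mu.-integrable `]0, +oo[ (EFin \o h m)) /\
  poly_approx 1 (fun x => x^-1 `^ q^-1 * \int[mu]_(s in `]0, +oo[) h x^-1 s)
    (laplace_poly q a c N) N.
Proof.
move=> q1 a0 mh [C [C0 HC]].
pose co l k m := (- m) ^+ l / l`!%:R * c l k.
pose L m s := \sum_(l < N) \sum_(k < N) co l k m * moment_fun q (a * m) (2 * l + k) s.
have LE m s : laplace_partial a c N m (s `^ q) = L m s.
  rewrite /laplace_partial mulr_sumr; apply: eq_bigr => l _.
  rewrite !mulr_sumr; apply: eq_bigr => k _.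
  by rewrite /moment_fun /co exprD mulrA; ring.
have iL m : 0 < m -> mu.-integrable `]0, +oo[ (EFin \o L m) /\
    \int[mu]_(s in `]0, +oo[) L m s =
    \sum_(l < N) \sum_(k < N) co l k m * moment q (a * m) (2 * l + k).
  move=> m0; have am0 : 0 < a * m by rewrite mulr_gt0.
  have i1 l k : mu.-integrable `]0, +oo[
      (EFin \o (fun s => co l k m * moment_fun q (a * m) (2 * l + k) s)).
    exact: (integrableZl _ _ (integrable_moment _ q1 am0)).
  have i2 l := @integrable_Rintegral_sum `]0, +oo[ N
    (fun k s => co l k m * moment_fun q (a * m) (2 * l + k) s) (measurable_itv _)
    (fun k _ => i1 l k).
  have [i3 E3] := @integrable_Rintegral_sum `]0, +oo[ N
    (fun l s => \sum_(k < N) co l k m * moment_fun q (a * m) (2 * l + k) s)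
    (measurable_itv _) (fun l _ => (i2 l).1).
  split=> //; rewrite E3; apply: eq_bigr => l _; rewrite (i2 l).2.
  apply: eq_bigr => k _; rewrite RintegralZl//; exact: integrable_moment.
have iB m : 0 < m -> mu.-integrable `]0, +oo[
    (EFin \o (fun s => C / m ^+ N * moment_fun q (a / 4 * m) 0 s)).
  move=> m0; apply: (integrableZl _ _ (integrable_moment _ q1 _)) => //.
  by rewrite mulr_gt0// divr_gt0.
have bE m s : 1 <= m -> 0 < s -> `|h m s - L m s| <= C / m ^+ N * moment_fun q (a / 4 * m) 0 s.
  move=> m1 s0; rewrite -LE (le_trans (HC m s m1 s0))// /moment_fun expr0 mul1r.
  by rewrite le_eqVlt; apply/orP; left; apply/eqP; rewrite [a / 4 * (m * _)]mulrA; ring.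
have iE m : 1 <= m -> mu.-integrable `]0, +oo[ (EFin \o (fun s => h m s - L m s)).
  move=> m1; have m0 := lt_le_trans ltr01 m1.
  apply: le_integrable (iB m m0) => //.
    apply/measurable_EFinP; apply: measurable_funB.
      exact: mh.
    by have /integrableP[/measurable_EFinP] := (iL m m0).1.
  move=> s /=; rewrite in_itv/= andbT => s0; rewrite lee_fin (le_trans (bE m s m1 s0))//.
  exact: ler_norm.
have ih m : 1 <= m -> mu.-integrable `]0, +oo[ (EFin \o h m).
  move=> m1; have m0 := lt_le_trans ltr01 m1.
  apply: eq_integrable (integrableD _ (iE m m1) (iL m m0).1) => // s _ /=.
  by rewrite -EFinD subrK.
split=> //.
exists (C * (Gamma q^-1 / q * (a / 4) `^ (- q^-1))) => x /andP[x0 x1].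
pose m := x^-1; have m0 : 0 < m by rewrite invr_gt0.
have m1 : 1 <= m by rewrite /m invf_ge1.
have mq : m `^ (- q^-1) * m `^ q^-1 = 1.
  by rewrite powRN mulVf// gt_eqF// powR_gt0.
have -> : (laplace_poly q a c N).[x] = m `^ q^-1 * \int[mu]_(s in `]0, +oo[) L m s.
  rewrite (iL m m0).2 /laplace_poly horner_sum mulr_sumr; apply: eq_bigr => l _.
  rewrite horner_sum mulr_sumr; apply: eq_bigr => k _.
  rewrite hornerZ hornerXn moment_scale ?mulr_gt0// powRM ?(ltW a0) ?(ltW m0)//.
  have xm : x ^+ (l + k) = (m ^+ l)^-1 / m ^+ k by rewrite /m -exprVn -exprVn invrK exprD.
  have m2 : m ^+ (2 * l + k) = m ^+ l * m ^+ l * m ^+ k by rewrite exprD mul2n -addnn exprD.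
  rewrite /co xm (exprNn m l) exprMn m2.
  set A := a ^+ _; set S := a `^ _; set G := Gamma _; set M := m ^+ l; set K := m ^+ k.
  rewrite [RHS](_ : _ = (-1) ^+ l * M / l`!%:R * c l k * (G / q / (A * (M * M * K)) * S)
    * (m `^ (- q^-1) * m `^ q^-1)); last by ring.
  rewrite mq mulr1.
  have A0 : A != 0 by rewrite gt_eqF// exprn_gt0.
  have M0 : M != 0 by rewrite gt_eqF// exprn_gt0.
  have K0 : K != 0 by rewrite gt_eqF// exprn_gt0.
  have q0 : q != 0 by rewrite gt_eqF// (lt_trans ltr01).
  have l0 : l`!%:R != 0 :> R by rewrite pnatr_eq0 -lt0n fact_gt0.
  by field; rewrite A0 M0 K0 q0 l0.
rewrite -/m -mulrBr -RintegralB//; [|exact: ih|exact: (iL m m0).1].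
rewrite normrM (ger0_norm (powR_ge0 _ _)).
apply: (@le_trans _ _ (m `^ q^-1 * \int[mu]_(s in `]0, +oo[) (C / m ^+ N * moment_fun q (a / 4 * m) 0 s))).
  rewrite ler_wpM2l ?powR_ge0// (le_trans (le_normr_Rintegral _ (iE m m1)))//.
  apply: le_Rintegral => //.
  - exact: (integrable_norm (iE m m1)).
  - exact: iB.
  - by move=> s /=; rewrite in_itv/= andbT => s0; exact: bE.
rewrite RintegralZl//; last first.
  by apply: integrable_moment; rewrite // mulr_gt0// divr_gt0.
rewrite -/(moment _ _ _) moment_scale ?mulr_gt0 ?divr_gt0//.
rewrite powRM ?(ltW m0) ?(ltW (divr_gt0 a0 _))// add0r expr0 divr1.
have xm : x ^+ N = (m ^+ N)^-1 by rewrite /m -exprVn invrK.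
rewrite xm le_eqVlt; apply/orP; left; apply/eqP.
rewrite [LHS](_ : _ = C * (Gamma q^-1 / q * (a / 4) `^ (- q^-1)) / m ^+ N *
  (m `^ (- q^-1) * m `^ q^-1)); last by ring.
by rewrite mq mulr1.
Qed.

End LaplaceIntegral.

(** * The generalised arcsine and sine *)

Section GeneralisedArcsine.
Context {R : realType} (p q : R) (hp : 1 < p) (hq : 1 < q).
Local Notation mu := (@lebesgue_measure R).
Implicit Types s t x : R.

Let p0 : 0 < p. Proof. exact: lt_trans hp. Qed.
Let q0 : 0 < q. Proof. exact: lt_trans hq. Qed.
Let pV0 : 0 < p^-1. Proof. by rewrite invr_gt0. Qed.

Definition arc_density t : R := (1 - t `^ q) `^ (- p^-1).
Local Notation f := arc_density.
Local Notation F := (garcsin p q).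
Local Notation X := (F 1).

Lemma measurable_arc_density : measurable_fun [set: R] f.
Proof.
apply: (@measurableT_comp _ _ _ _ _ _ (fun x : R => x `^ (- p^-1))).
  exact: measurable_powR.
by apply: measurable_funB => //; exact: measurable_powR.
Qed.

Let one_powR r : 1 `^ r = 1 :> R. Proof. by rewrite powR1. Qed.

Lemma powR_lt1 t : 0 <= t -> t < 1 -> t `^ q < 1.
Proof.
move=> t0 t1; rewrite -[X in _ < X](one_powR q).
by rewrite gt0_ltr_powR ?nnegrE.
Qed.

Lemma powR_itv01 t : 0 < t -> t < 1 -> 0 < 1 - t `^ q < 1.
Proof.
move=> t0 t1; rewrite subr_gt0 powR_lt1 ?(ltW t0)//=.
by rewrite gtrDl oppr_lt0 powR_gt0.
Qed.

Lemma arc_density_gt1 t : 0 < t -> t < 1 -> 1 < f t.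
Proof.
move=> t0 t1; have /andP[u0 u1] := powR_itv01 t0 t1.
rewrite /f powRN invf_gt1 ?powR_gt0//.
rewrite -[X in _ < X](one_powR p^-1).
by rewrite gt0_ltr_powR ?nnegrE ?(ltW u0).
Qed.

Lemma arc_density_le s t : 0 <= s -> s <= t -> t < 1 -> f s <= f t.
Proof.
move=> s0 st t1.
have t0 := le_trans s0 st.
have u0 : 0 < 1 - t `^ q by rewrite subr_gt0 powR_lt1.
have uv : 1 - t `^ q <= 1 - s `^ q by rewrite lerD2l lerN2 ge0_ler_powR ?nnegrE ?(ltW q0).
have v0 := lt_le_trans u0 uv.
by rewrite /f !powRN lef_pV2 ?posrE ?powR_gt0// ge0_ler_powR ?nnegrE ?(ltW u0) ?(ltW v0) ?(ltW pV0).
Qed.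

(** The singularity at [1] is integrable because [1 - t <= 1 - t^q] and
    [1/p < 1]. *)
Lemma integrable_arc_density : mu.-integrable `[0, 1] (EFin \o f).
Proof.
pose be := 1 - p^-1.
have be0 : 0 < be by rewrite subr_gt0 invf_lt1.
pose g t : R := (1 - t) `^ (- p^-1).
have mg : measurable_fun [set: R] g.
  apply: (@measurableT_comp _ _ _ _ _ _ (fun x : R => x `^ (- p^-1))).
    exact: measurable_powR.
  by apply: measurable_funB.
have g0 t : 0 <= g t by exact: powR_ge0.
have fg t : 0 <= t <= 1 -> f t <= g t.
  move=> /andP[t0 t1].
  have [->|t1'] := eqVneq t 1.
    by rewrite /f /g powR1 subrr.
  have {}t1 : t < 1 by rewrite lt_neqAle t1'.
  rewrite /f /g !powRN lef_pV2 ?posrE ?powR_gt0 ?subr_gt0 ?powR_lt1//.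
  rewrite ge0_ler_powR ?nnegrE ?subr_ge0 ?(ltW pV0) ?(ltW t1) ?(ltW (powR_lt1 _ _))//.
  rewrite lerD2l lerN2 -[leRHS]powRr1//.
  move: t0; rewrite le_eqVlt => /predU1P[<-|t0]; first by rewrite !powR0 ?gt_eqF.
  by apply: ger_powR; rewrite ?t0 ?(ltW t1) ?(ltW hq).
pose b n : R := 1 - n.+2%:R^-1.
have b01 n : 0 < b n < 1.
  rewrite /b subr_gt0 invf_lt1// ltr1n/=.
  by rewrite gtrDl oppr_lt0 invr_gt0.
have intb n : (\int[mu]_(t in `[0%R, b n]) (g t)%:E <= (be^-1)%:E)%E.
  have /andP[b0 b1] := b01 n.
  pose G t : R := - be^-1 * (1 - t) `^ (- - be).
  have Gd t : 0 <= t <= b n -> is_derive t (1 : R) G (g t).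
    move=> /andP[t0 tb]; have := is_derive_onem_powR (- be) (le_lt_trans tb b1).
    move=> D; apply: (trigger_derive (is_deriveZ (- be^-1) D)).
    rewrite /GRing.scale /= mulrA mulrNN mulVf ?mul1r ?gt_eqF// /g.
    by congr (_ `^ _); rewrite /be; ring.
  have Gc : {within `[0, b n], continuous G} := derivable_within_itv Gd.
  have /(continuous_within_itvP _ b0)[Gc1 Gc2 Gc3] := Gc.
  rewrite (@continuous_FTC2 _ g G)//.
  - rewrite -EFinB lee_fin /G subr0 powR1 mulr1 opprK mulNr addrC opprK.
    by rewrite gerDl oppr_le0 mulr_ge0 ?invr_ge0 ?powR_ge0 ?(ltW be0).
  - apply: derivable_within_itv => t /andP[t0 tb].
    exact: (is_derive_onem_powR p^-1 (le_lt_trans tb b1)).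
  - split=> // t; rewrite in_itv/= => /andP[t0 tb].
    by have D := Gd t; apply: ex_derive; apply: Gd; rewrite !ltW.
  - move=> t; rewrite in_itv/= => /andP[t0 tb].
    have D : is_derive t (1 : R) G (g t) by apply: Gd; rewrite !ltW.
    by rewrite derive1E; exact: derive_val.
have cvg_b : (\int[mu]_(t in `[0%R, b n]) (g t)%:E @[n --> \oo] -->
    \int[mu]_(t in `[0%R, 1%R[) (g t)%:E)%E.
  have -> : `[0%R, 1%R[%classic = \bigcup_n `[0%R, b n]%classic.
    apply/seteqP; split => x /=; rewrite in_itv/=.
      move=> /andP[x0 x1].
      have x1' : 0 < 1 - x by rewrite subr_gt0.
      have [n /andP[an _]] := exh_exhausts x1'.
      exists n => //=; rewrite in_itv/= x0/= /b.
      by rewrite lerBrDr -lerBrDl.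
    move=> [n _ /=]; rewrite in_itv/= => /andP[-> xb].
    by have /andP[_ b1] := b01 n; rewrite (le_lt_trans xb).
  apply: ge0_nondecreasing_set_cvg_integral.
  - move=> n m nm; rewrite subsetEset => x /=; rewrite !in_itv/= => /andP[-> xb].
    by rewrite (le_trans xb)// /b lerD2l lerN2 exh_lo_noninc.
  - by move=> n.
  - by move=> n; apply/measurable_EFinP; exact: measurable_funTS.
  - by move=> n x _; rewrite lee_fin.
have ig : mu.-integrable `[0, 1] (EFin \o g).
  apply/integrableP; split; first by apply/measurable_EFinP; exact: measurable_funTS.
  under eq_integral do rewrite /= ger0_norm//.
  rewrite -integral_itv_bndo_bndc; last by apply/measurable_EFinP; exact: measurable_funTS.
  apply: (@le_lt_trans _ _ (be^-1)%:E); last exact: ltry.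
  rewrite -(cvg_lim _ cvg_b)//; apply: lime_le.
    by apply/cvg_ex; eexists; exact: cvg_b.
  by near=> n; exact: intb.
apply: le_integrable ig => //.
  by apply/measurable_EFinP; apply: measurable_funTS; exact: measurable_arc_density.
move=> t t01; rewrite /= lee_fin !ger0_norm ?powR_ge0//.
by apply: fg; move: t01; rewrite /= in_itv.
Unshelve. all: by end_near.
Qed.


Lemma garcsin_within_continuous : {within `[0, 1], continuous F}.
Proof. exact: parameterized_integral_continuous ler01 integrable_arc_density. Qed.

Lemma garcsin0 : F 0 = 0.
Proof. by rewrite /garcsin set_itv1 Rintegral_set1. Qed.

Lemma is_derive_garcsin s : 0 < s -> s < 1 -> is_derive s (1 : R) F (f s).
Proof.
move=> s0 s1.
have [u0 _] := andP (powR_itv01 s0 s1).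
have cf : {for s, continuous f}.
  have D1 := is_derive1_powR q s0.
  have D2 := @is_derive1_powR R (- p^-1) _ u0.
  apply: (@continuous_comp _ _ _ (fun t => 1 - t `^ q) (fun x => x `^ (- p^-1))).
    apply: cvgB; first exact: cvg_cst.
    exact: (is_derive_continuous D1).
  exact: (is_derive_continuous D2).
have [D E] := continuous_FTC1_closed s1 integrable_arc_density s0 cf.
by apply: DeriveDef => //; rewrite -E derive1E.
Qed.

Lemma garcsin_MVT s t : 0 <= s -> s < t -> t <= 1 ->
  exists2 c, s < c < t & F t - F s = f c * (t - s).
Proof.
move=> s0 st t1.
have Fd x : x \in `]s, t[ -> is_derive x 1 F (f x).
  rewrite in_itv/= => /andP[sx xt]; apply: is_derive_garcsin.
    exact: le_lt_trans sx.
  exact: lt_le_trans t1.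
have Fc : {within `[s, t], continuous F}.
  apply: continuous_subspaceW garcsin_within_continuous => x /=.
  by rewrite !in_itv/= => /andP[sx xt]; rewrite (le_trans s0)// (le_trans xt).
by have [c + E] := MVT st Fd Fc; rewrite in_itv/= => sct; exists c.
Qed.

(** The density exceeds [1] inside the unit interval, hence [F] expands distances. *)
Lemma garcsin_expands s t : 0 <= s -> s < t -> t <= 1 -> t - s < F t - F s.
Proof.
move=> s0 st t1; have [c /andP[sc ct] ->] := garcsin_MVT s0 st t1.
rewrite ltr_pMl ?subr_gt0// arc_density_gt1//; first exact: le_lt_trans sc.
exact: lt_le_trans t1.
Qed.

Lemma garcsin_lt s t : 0 <= s -> s < t -> t <= 1 -> F s < F t.
Proof.
move=> s0 st t1; rewrite -subr_gt0; apply: lt_trans (garcsin_expands s0 st t1).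
by rewrite subr_gt0.
Qed.

Lemma garcsin_le s t : 0 <= s -> s <= t -> t <= 1 -> F s <= F t.
Proof.
by move=> s0; rewrite le_eqVlt => /predU1P[->//|st] t1; exact/ltW/garcsin_lt.
Qed.

Lemma garcsin_gt s : 0 < s -> s <= 1 -> s < F s.
Proof. by move=> s0 s1; have := garcsin_expands (lexx 0) s0 s1; rewrite garcsin0 !subr0. Qed.

(** The mean value is at most the final value, since the density is nondecreasing. *)
Lemma garcsin_le_density s : 0 < s -> s < 1 -> F s <= s * f s.
Proof.
move=> s0 s1; have [c /andP[c0 cs]] := garcsin_MVT (lexx 0) s0 (ltW s1).
rewrite garcsin0 !subr0 => ->; rewrite mulrC ler_wpM2l ?(ltW s0)//.
by rewrite arc_density_le// ltW.
Qed.

Lemma garcsin1_gt1 : 1 < X. Proof. exact: garcsin_gt. Qed.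

Let X0 : 0 < X. Proof. exact: lt_trans garcsin1_gt1. Qed.

Lemma garcsin_ge0 s : 0 <= s -> s <= 1 -> 0 <= F s.
Proof. by move=> s0 s1; rewrite -garcsin0 garcsin_le. Qed.

Lemma garcsin_inj : {in `[0, 1] &, injective F}.
Proof.
move=> s t; rewrite !in_itv/= => /andP[s0 s1] /andP[t0 t1] st.
by case: (ltgtP s t) => // /garcsin_lt H; [have := H s0 t1|have := H t0 s1]; rewrite st ltxx.
Qed.

Lemma garcsin_surj x : 0 <= x -> x <= X -> exists2 s, 0 <= s <= 1 & F s = x.
Proof.
move=> x0 xX; have [|s] := IVT ler01 garcsin_within_continuous (v := x).
  by rewrite garcsin0 min_l ?max_r ?x0 ?xX// ltW.
by rewrite in_itv/= => s01 <-; exists s.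
Qed.

Lemma garcsinK s : 0 <= s <= 1 -> 'pinv_(fun=> 0) `[0, 1] F (F s) = s.
Proof.
move=> s01; apply: pinvKV; last by rewrite inE/= in_itv.
by move=> x y; rewrite !inE/=; exact: garcsin_inj.
Qed.

(** The inverse of [F], clamped so as to be nondecreasing, hence measurable, on the
    whole line; it agrees with the partial inverse wherever [gsin] evaluates it. *)
Definition arc_inv x : R := 'pinv_(fun=> 0) `[0, 1] F (Num.min (Num.max x 0) X).

Lemma arc_inv_spec x : exists2 s, 0 <= s <= 1 &
  F s = Num.min (Num.max x 0) X /\ arc_inv x = s.
Proof.
have [||s s01 E] := @garcsin_surj (Num.min (Num.max x 0) X).
- by rewrite le_min le_max lexx orbT/= ltW.
- by rewrite ge_min lexx orbT.
by exists s => //; split=> //; rewrite /arc_inv -E garcsinK.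
Qed.

Lemma arc_inv_nondecreasing : nondecreasing_fun arc_inv.
Proof.
move=> x y xy; have [s /andP[s0 s1] [Es ->]] := arc_inv_spec x.
have [t /andP[t0 t1] [Et ->]] := arc_inv_spec y.
rewrite leNgt; apply/negP => /garcsin_lt -/(_ t0 s1); rewrite Es Et; apply/negP.
by rewrite -leNgt le_min2// le_max2.
Qed.

Lemma arc_inv_itv01 x : 0 <= arc_inv x <= 1.
Proof. by have [s s01 [_ ->]] := arc_inv_spec x. Qed.

Lemma arc_invE x : 0 <= x <= X -> 'pinv_(fun=> 0) `[0, 1] F x = arc_inv x.
Proof. by move=> /andP[x0 xX]; rewrite /arc_inv max_l// min_l. Qed.

Definition clamped_gsin_half x : R := if x <= X then arc_inv x else arc_inv (2 * X - x).

Definition clamped_gsin x : R :=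
  let T := 2 * (2 * X) in
  let r := x - T * (Num.floor (x / T))%:~R in
  if r <= 2 * X then clamped_gsin_half r else - clamped_gsin_half (T - r).

Lemma clamped_gsin_halfE x : 0 <= x <= 2 * X -> gsin_half p q x = clamped_gsin_half x.
Proof.
move=> /andP[x0 xX]; rewrite /gsin_half /clamped_gsin_half /gpi.
have -> : 2 * X / 2 = X by field.
case: leP => xX'; first by rewrite arc_invE// x0.
by rewrite arc_invE// subr_ge0 xX /=; lra.
Qed.

Lemma period_residue T x : 0 < T -> 0 <= x - T * (Num.floor (x / T))%:~R < T.
Proof.
move=> T0; have /andP[l u] := floor_itv (x / T).
rewrite subr_ge0 ltrBlDr; apply/andP; split.
  by rewrite mulrC -ler_pdivlMr.
by move: u; rewrite ltr_pdivrMr// intrD mulrDl mul1r mulrC addrC.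
Qed.

Lemma clamped_gsinE x : gsin p q x = clamped_gsin x.
Proof.
rewrite /gsin /clamped_gsin /gpi; set T := 2 * (2 * X).
have T0 : 0 < T by rewrite /T; have := X0; lra.
have /andP[r0 rT] := period_residue x T0; set r := x - _ in r0 rT *.
case: leP => r2; first by rewrite clamped_gsin_halfE// r0.
by rewrite clamped_gsin_halfE// subr_ge0 (ltW rT)/= /T; lra.
Qed.

Lemma clamped_gsin_half_norm x : `|clamped_gsin_half x| <= 1.
Proof.
rewrite /clamped_gsin_half; case: ifP => _.
  by have /andP[a b] := arc_inv_itv01 x; rewrite ger0_norm.
by have /andP[a b] := arc_inv_itv01 (2 * X - x); rewrite ger0_norm.
Qed.

Lemma gsin_norm_le1 x : `|gsin p q x| <= 1.
Proof. by rewrite clamped_gsinE /clamped_gsin; case: ifP => _; rewrite ?normrN clamped_gsin_half_norm. Qed.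

Lemma gsin_garcsin s : 0 <= s <= 1 -> gsin p q (F s) = s.
Proof.
move=> /[dup] s01 /andP[s0 s1].
have Fs0 := garcsin_ge0 s0 s1; have FsX : F s <= X by exact: garcsin_le.
rewrite /gsin /gpi; set T := 2 * (2 * X).
have T0 : 0 < T by rewrite /T; have := X0; lra.
have -> : Num.floor (F s / T) = 0.
  apply: floor_def; rewrite mulr0z add0r divr_ge0 ?(ltW T0)//= ltr_pdivrMr// mul1r.
  by rewrite /T; have := X0; lra.
rewrite mulr0 subr0 ifT; last by have := X0; lra.
rewrite /gsin_half /gpi ifT ?garcsinK//.
by have := X0; lra.
Qed.

Lemma measurable_arc_inv : measurable_fun [set: R] arc_inv.
Proof. by apply: nondecreasing_measurable => //; exact: arc_inv_nondecreasing. Qed.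

Lemma measurable_gsin : measurable_fun [set: R] (gsin p q).
Proof.
rewrite (_ : gsin p q = clamped_gsin); last by apply/funext => x; exact: clamped_gsinE.
have mh : measurable_fun [set: R] clamped_gsin_half.
  apply: measurable_fun_ifT; first exact: measurable_fun_ler.
    exact: measurable_arc_inv.
  apply: measurableT_comp; first exact: measurable_arc_inv.
  exact: measurable_funB.
have mr : measurable_fun [set: R] (fun x : R =>
    x - 2 * (2 * X) * (Num.floor (x / (2 * (2 * X))))%:~R : R).
  apply: measurable_funB => //; apply: measurable_funM => //.
  apply: nondecreasing_measurable => // x y xy.
  rewrite ler_int le_floor// ler_wpM2r// invr_ge0.
  by have := X0; lra.
apply: measurable_fun_ifT.
- exact: measurable_fun_ler.
- exact: measurableT_comp mr.
- apply: measurableT_comp => //; apply: measurableT_comp => //.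
  exact: measurable_funB.
Qed.


Lemma gsinc_garcsin s : 0 < s -> s <= 1 -> gsinc p q (F s) = s / F s.
Proof.
move=> s0 s1; rewrite /gsinc gt_eqF ?gsin_garcsin ?(ltW s0)//.
exact: lt_trans (garcsin_gt s0 s1).
Qed.

(** Inversion is expressed as a real power, whose measurability is known; it agrees with
    [x^-1] because [x >= 0]. *)
Lemma measurable_gsinc_powR (m : R) :
  measurable_fun (`[0, +oo[ : set R) (fun x : R => `|gsinc p q x| `^ m).
Proof.
pose k (x : R) : R := if x == 0 then 1 `^ m else (`|gsin p q x| * x `^ (- 1)) `^ m.
have mk : measurable_fun [set: R] k.
  apply: measurable_fun_ifT => //; first exact: measurable_fun_eqr.
  apply: (@measurableT_comp _ _ _ _ _ _ (fun x : R => x `^ m)).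
    exact: measurable_powR.
  apply: measurable_funM; last exact: measurable_powR.
  by apply: measurableT_comp => //; exact: measurable_gsin.
apply: (eq_measurable_fun k); last exact: measurable_funTS.
move=> x; rewrite inE/= in_itv/= andbT => x0.
rewrite /k /gsinc; case: eqP => [_|_]; first by rewrite normr1.
by rewrite normrM normfV powR_inv1// (ger0_norm x0).
Qed.

(** With [x = F s]: [s / F s >= (1 - s^q)^(1/p) >= 1 - s^q >= 1 - s >= 1 - x]. This gives
    the continuity of the quotient at the origin. *)
Lemma gsinc_ge_1B x : 0 < x -> x < X -> 1 - x <= gsinc p q x <= 1.
Proof.
move=> x0 xX; have [s /andP[s0 s1] Fs] := garcsin_surj (ltW x0) (ltW xX).
have {}s0 : 0 < s.
  by rewrite lt_neqAle s0 andbT; apply: contraTneq x0 => E; rewrite -Fs -E garcsin0 ltxx.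
have {}s1 : s < 1.
  by rewrite lt_neqAle s1 andbT; apply: contraTneq xX => E; rewrite -Fs -E ltxx.
rewrite -Fs gsinc_garcsin ?(ltW s1)//; rewrite -Fs in x0 xX.
have sF := ltW (garcsin_gt s0 (ltW s1)).
apply/andP; split; last by rewrite ler_pdivrMr// mul1r.
have /andP[u0 u1] := powR_itv01 s0 s1.
apply: (@le_trans _ _ (1 - s)); first by rewrite lerD2l lerN2.
apply: (@le_trans _ _ (1 - s `^ q)).
  by rewrite lerD2l lerN2 ge1r_powR ?s0 ?(ltW s1) ?(ltW hq).
apply: (@le_trans _ _ ((1 - s `^ q) `^ p^-1)).
  by rewrite ger1_powR ?u0 ?(ltW u1)// invf_le1// ltW.
rewrite ler_pdivlMr// (le_trans (ler_wpM2l (powR_ge0 _ _) (garcsin_le_density s0 s1)))//.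
rewrite mulrCA /f -powRD; last by rewrite (gt_eqF u0) implybT.
by rewrite subrr powRr0 mulr1.
Qed.

Lemma gsinc_within_continuous s0 : 0 < s0 -> s0 < 1 ->
  {within `[0, F s0], continuous (gsinc p q)}.
Proof.
move=> s00 s01; have F0 : 0 < F s0 by exact: lt_trans (garcsin_gt s00 (ltW s01)).
have FX : F s0 < X by exact: garcsin_lt (ltW s00) s01 (lexx 1).
have gc : {within `[0, F s0], continuous (gsin p q)}.
  rewrite -[X in `[X, _]]garcsin0; apply: segment_can_le_continuous (ltW s00) _ _.
    apply: continuous_subspaceW garcsin_within_continuous => x /=.
    by rewrite !in_itv/= => /andP[-> xs]; rewrite (le_trans xs)// ltW.
  move=> s; rewrite in_itv/= => /andP[s0' ss]; apply: gsin_garcsin.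
  by rewrite s0' (le_trans ss)// ltW.
have /(continuous_within_itvP _ F0)[g1 g2 g3] := gc.
have eqg x : x != 0 -> gsin p q x * x^-1 = gsinc p q x.
  by move=> x0; rewrite /gsinc (negbTE x0).
apply/(continuous_within_itvP _ F0); split.
- move=> x /[dup] xi; rewrite in_itv/= => /andP[x0 xF].
  apply: (cvg_trans (near_eq_cvg (_ : {near x, (fun y => gsin p q y * y^-1) =1 gsinc p q}))).
    near=> y; apply: eqg; near: y.
    by apply: (cvgr_neq0 x); [exact: cvg_id|rewrite gt_eqF].
  rewrite -eqg ?gt_eqF//; apply: cvgM; first exact: g1.
  by apply: cvgV; rewrite ?gt_eqF//; exact: cvg_id.
- rewrite [gsinc p q 0]/gsinc eqxx.
  apply: (@squeeze_cvgr _ _ _ _ (fun x => 1 - x) (cst 1)).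
  + near=> x; apply: gsinc_ge_1B.
      by near: x; exact: nbhs_right_gt.
    by rewrite (lt_trans _ FX)//; near: x; exact: nbhs_right_lt.
  + rewrite -[X in _ --> X]subr0; apply: cvgB; first exact: cvg_cst.
    by apply: cvg_at_right_filter; exact: cvg_id.
  + exact: cvg_cst.
- apply: (cvg_trans (near_eq_cvg (_ : {near (F s0)^'-, (fun y => gsin p q y * y^-1) =1 gsinc p q}))).
    near=> y; apply: eqg; rewrite gt_eqF//; near: y; exact: nbhs_left_gt.
  rewrite -eqg ?gt_eqF//; apply: cvgM; first exact: g3.
  by apply: cvgV; rewrite ?gt_eqF//; apply: cvg_at_left_filter; exact: cvg_id.
Unshelve. all: by end_near.
Qed.


Lemma gsinc_norm_le_inv x : 0 < x -> `|gsinc p q x| <= x^-1.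
Proof.
move=> x0; rewrite /gsinc gt_eqF// normrM normfV (gtr0_norm x0).
by rewrite ler_piMl ?gsin_norm_le1// invr_ge0 ltW.
Qed.

(** Away from the origin the quotient is bounded away from [1]: on the first quarter
    period because [F s - s] increases, beyond it because [x > X]. *)
Lemma gsinc_norm_le_tail s0 x : 0 < s0 -> s0 < 1 -> F s0 < x ->
  `|gsinc p q x| <= (1 + (F s0 - s0))^-1.
Proof.
move=> s00 s01 sx; have e0 : 0 < F s0 - s0 by rewrite subr_gt0 garcsin_gt// ltW.
have e1 : 0 < 1 + (F s0 - s0) := addr_gt0 ltr01 e0.
have x0 : 0 < x by rewrite (lt_trans _ sx)// (lt_trans s00)// garcsin_gt// ltW.
have XE : 1 + (F s0 - s0) <= X.
  have := garcsin_expands (ltW s00) s01 (lexx 1); lra.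
have [xX|Xx] := leP x X; last first.
  rewrite (le_trans (gsinc_norm_le_inv x0))// lef_pV2 ?posrE ?e1//.
  by rewrite (le_trans XE)// ltW.
have [s /andP[s0' s1] Fs] := garcsin_surj (ltW x0) xX.
have ss : s0 < s.
  rewrite ltNge; apply/negP => /(garcsin_le s0') -/(_ (ltW s01)).
  by rewrite Fs leNgt sx.
have sp : 0 < s by exact: lt_trans ss.
rewrite -Fs gsinc_garcsin//; rewrite -Fs in x0.
rewrite ger0_norm ?divr_ge0 ?(ltW x0)//.
rewrite ler_pdivrMr// ler_pdivlMl//.
have := garcsin_expands (ltW s00) ss s1.
have : (F s0 - s0) * s <= F s0 - s0 by rewrite ler_piMr// ltW.
lra.
Qed.

(** Two factors of [|gsinc x|^m] are at most [1 / x], which makes the integral converge;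
    the other [m - 2] are at most [rho < 1]. *)
Lemma gsinc_tail_integral s0 : 0 < s0 -> s0 < 1 ->
  exists C ka : R, [/\ 0 <= C, 0 < ka & forall m, 2 <= m ->
    (\int[mu]_(x in `]F s0, +oo[) (`|gsinc p q x| `^ m)%:E <= (C * expR (- (ka * m)))%:E)%E].
Proof.
move=> s00 s01; set x0 := F s0.
have x00 : 0 < x0 by rewrite (lt_trans s00)// garcsin_gt// ltW.
have e0 : 0 < x0 - s0 by rewrite subr_gt0 garcsin_gt// ltW.
set rho := (1 + (x0 - s0))^-1.
have e1 : 0 < 1 + (x0 - s0) := addr_gt0 ltr01 e0.
have r0 : 0 < rho by rewrite invr_gt0.
have r1 : rho < 1 by rewrite invf_lt1// ltrDl.
pose K := 1 + x0 ^- 2.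
have K0 : 0 <= K by rewrite addr_ge0// invr_ge0 exprn_ge0// ltW.
exists (expR (- (2 * ln rho)) * K * (pi / 2)), (- ln rho); split.
- by rewrite !mulr_ge0 ?expR_ge0 ?pi_ge0.
- by rewrite oppr_gt0 ln_lt0// r0.
move=> m m2.
have bound x : x0 < x -> `|gsinc p q x| `^ m <= rho `^ (m - 2) * K * (oneDsqr x)^-1.
  move=> xx; have xp : 0 < x by exact: lt_trans xx.
  rewrite -[in leLHS](subrK 2 m) powRD; last by rewrite subrK gt_eqF// (lt_le_trans _ m2).
  rewrite -mulrA ler_pM ?powR_ge0//.
    rewrite ge0_ler_powR ?nnegrE ?subr_ge0 ?(ltW r0)//.
    exact: gsinc_norm_le_tail.
  rewrite powR_mulrn// (@le_trans _ _ (x^-1 ^+ 2))//.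
    by rewrite lerXn2r ?nnegrE ?invr_ge0 ?(ltW xp)// gsinc_norm_le_inv.
  rewrite ler_pdivlMr ?(lt_le_trans ltr01 (oneDsqr_ge1 x))// /oneDsqr exprVn.
  rewrite mulrDr mulr1 mulVf ?expf_neq0 ?gt_eqF// addrC lerD2l.
  by rewrite lef_pV2 ?posrE ?exprn_gt0// lerXn2r ?nnegrE ?(ltW x00) ?(ltW xp)// ltW.
have c0 : 0 <= rho `^ (m - 2) * K by rewrite mulr_ge0 ?powR_ge0.
have mD : measurable_fun [set: R] (fun x : R => (oneDsqr x)^-1).
  by apply: continuous_measurable_fun; exact: continuous_oneDsqrV.
have D0 x : 0 <= (oneDsqr x : R)^-1.
  by rewrite invr_ge0 (le_trans ler01)// oneDsqr_ge1.
apply: (@le_trans _ _ (\int[mu]_(x in `]x0, +oo[) ((rho `^ (m - 2) * K)%:E * ((oneDsqr x)^-1)%:E))%E).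
  apply: ge0_le_integral => //.
  - apply/measurable_EFinP; apply: measurable_funS (measurable_gsinc_powR m) => //.
    by move=> x /=; rewrite !in_itv/= !andbT => /ltW; apply: le_trans; exact: ltW.
  - apply/measurable_EFinP; apply: measurable_funM => //.
    exact: measurable_funTS.
  - by move=> x /=; rewrite in_itv/= andbT => xx; rewrite lee_fin bound.
rewrite ge0_integralZl//; last by apply/measurable_EFinP; exact: measurable_funTS.
apply: (@le_trans _ _ ((rho `^ (m - 2) * K)%:E * \int[mu]_(x in `[0%R, +oo[) ((oneDsqr x)^-1)%:E)%E).
  apply: lee_wpmul2l; first by rewrite lee_fin.
  apply: ge0_subset_integral => //.
  - by apply/measurable_EFinP; exact: measurable_funTS.
  - by move=> x /=; rewrite !in_itv/= !andbT => /ltW; apply: le_trans; exact: ltW.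
have E : rho `^ (m - 2) = expR (- (2 * ln rho)) * expR (- (- ln rho * m)).
  by rewrite /powR gt_eqF// -expRD; congr expR; ring.
rewrite integral0y_oneDsqr -EFinM lee_fin E le_eqVlt; apply/orP; left; apply/eqP.
by ring.
Qed.

(** The condition [s <= s0] is written in terms of [u = s^q], the variable of the
    pointwise expansion. *)
Definition cut_integrand s0 m s : R :=
  if s `^ q <= s0 `^ q then (s / F s) `^ m * f s else 0.

Lemma gsinc_substitution s0 m : 0 < s0 -> s0 < 1 ->
  measurable_fun (`]0, +oo[ : set R) (cut_integrand s0 m) /\
  (\int[mu]_(x in `[0%R, F s0]) (`|gsinc p q x| `^ m)%:E =
   \int[mu]_(s in `]0%R, +oo[) (cut_integrand s0 m s)%:E)%E.
Proof.
move=> s00 s01.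
have sub01 : `[0, s0] `<=` `[0, 1]%classic.
  by move=> x /=; rewrite !in_itv/= => /andP[-> xs]; rewrite (le_trans xs)// ltW.
have Fc : {within `[0, s0], continuous F}.
  exact: continuous_subspaceW garcsin_within_continuous.
have cut s : 0 < s -> (s `^ q <= s0 `^ q) = (s <= s0).
  move=> sp; apply/idP/idP => [|ss]; last first.
    by rewrite ge0_ler_powR ?nnegrE ?(ltW q0) ?(ltW sp) ?(ltW s00).
  by apply: contraTT; rewrite -!ltNge => ss; rewrite gt0_ltr_powR ?nnegrE ?(ltW sp) ?(ltW s00).
have setE : `]0, +oo[ `&` [set s | s `^ q <= s0 `^ q] = `]0, s0]%classic.
  apply/seteqP; split=> s /=; rewrite !in_itv/= ?andbT.
    by move=> [sp]; rewrite cut// sp.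
  by move=> /andP[sp ss]; rewrite cut.
have mh : measurable_fun (`]0, s0] : set R) (fun s => (s / F s) `^ m * f s).
  have mF : measurable_fun (`]0, s0] : set R) F.
    have : measurable_fun (`[0, s0] : set R) F.
      by apply: subspace_continuous_measurable_fun.
    by apply: measurable_funS => //; apply: subset_itvr; rewrite bnd_simp.
  apply: (eq_measurable_fun (fun s => (s * F s `^ (- 1)) `^ m * f s)).
    move=> s; rewrite inE/= in_itv/= => /andP[sp ss].
    by rewrite powR_inv1// garcsin_ge0 ?(ltW sp)// (le_trans ss)// ltW.
  apply: measurable_funM; last by apply: measurable_funTS; exact: measurable_arc_density.
  apply: (@measurableT_comp _ _ _ _ _ _ (fun x : R => x `^ m)).
    exact: measurable_powR.
  apply: measurable_funM => //.
  exact: (@measurableT_comp _ _ _ _ _ _ (fun x : R => x `^ (- 1)) _ F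
    (measurable_powR _) mF).
split.
  apply: measurable_fun_if => //.
  - apply: measurable_funTS; apply: measurable_fun_ler => //; exact: measurable_powR.
  - by rewrite (_ : _ `&` _ = `]0, s0]%classic)//; exact: setE.
rewrite -[X in `[X, _]%classic]garcsin0.
etransitivity; first apply: (@substitution_within R F f (fun x => `|gsinc p q x| `^ m)) => //.
- move=> x y; rewrite !in_itv/= => /andP[x0 _] /andP[_ y1] xy.
  by apply: garcsin_lt => //; rewrite (le_trans y1)// ltW.
- by move=> x /andP[x0 x1]; apply: is_derive_garcsin => //; exact: lt_trans s01.
- apply: (@within_itv_continuous_comp _ (fun t => t `^ q) (fun y => (1 - y) `^ (- p^-1))) => //.
    exact: powR_within_continuous.
  move=> x /andP[x0 xs].
  apply: is_derive_continuous (is_derive_onem_powR p^-1 _).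
  by apply: powR_lt1 => //; exact: le_lt_trans s01.
- rewrite garcsin0.
  apply: (@within_itv_continuous_comp _ (gsinc p q) (fun y => `|y| `^ m)).
  + exact: lt_trans (garcsin_gt s00 (ltW s01)).
  + exact: gsinc_within_continuous.
  + move=> x /andP[x0 xF].
    have gp : 0 < gsinc p q x.
      move: x0; rewrite le_eqVlt => /predU1P[<-|x0]; first by rewrite /gsinc eqxx.
      have xX : x < X by rewrite (le_lt_trans xF)// garcsin_lt// ltW.
      have [s /andP[s0' s1] Fs] := garcsin_surj (ltW x0) (ltW xX).
      have sp : 0 < s.
        by rewrite lt_neqAle s0' andbT; apply: contraTneq x0 => E; rewrite -Fs -E garcsin0 ltxx.
      by rewrite -Fs gsinc_garcsin// divr_gt0// Fs.
    apply: (@continuous_comp R R R (fun y : R => `|y|) (fun y : R => y `^ m)).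
      exact: norm_continuous.
    by apply: is_derive_continuous (is_derive1_powR m _); rewrite normr_gt0 gt_eqF.
have eqG s : s \in `]0, s0]%classic -> `|gsinc p q (F s)| `^ m * f s = (s / F s) `^ m * f s.
  rewrite inE/= in_itv/= => /andP[sp ss]; have s1 : s <= 1 by rewrite (le_trans ss)// ltW.
  by rewrite gsinc_garcsin// ger0_norm// divr_ge0 ?garcsin_ge0 ?(ltW sp).
rewrite -integral_itv_obnd_cbnd; last first.
  by apply/measurable_EFinP; apply: eq_measurable_fun mh => s /eqG.
under eq_integral => s /eqG -> do [].
rewrite -setE integral_mkcondr; apply: eq_integral => s _.
rewrite /cut_integrand patchE.
have -> // : (s \in [set s | s `^ q <= s0 `^ q]) = (s `^ q <= s0 `^ q).
  by apply/idP/idP => [/set_mem|sq]; last exact: mem_set.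
by case: ifP.
Qed.


(** [F s / s] as a function of [u = s^q]. *)
Definition arc_ratio u : R := F (u `^ q^-1) / u `^ q^-1.

Definition arc_ratio_coef k : R := binom_coef p^-1 k / (q * k%:R + 1).

Lemma powRKV u : 0 <= u -> (u `^ q^-1) `^ q = u.
Proof. by move=> u0; rewrite -powRrM mulVf ?gt_eqF// powRr1. Qed.

Lemma powR_root_itv01 u : 0 < u -> u < 1 -> 0 < u `^ q^-1 < 1.
Proof.
move=> u0 u1; rewrite powR_gt0//= -[X in _ < X](one_powR q^-1).
by rewrite gt0_ltr_powR ?nnegrE ?invr_gt0 ?(ltW u0).
Qed.

(** The binomial expansion of the density is integrated term by term: with
    [u = s^q], the monomial [u^k] has primitive [s u^k / (q k + 1)] in [s]. *)
Lemma arc_ratio_approx d n : 0 < d < 1 ->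
  poly_approx d arc_ratio (\poly_(k < n) arc_ratio_coef k) n.
Proof.
move=> d01; have [C [C0 HC]] := poly_approxP (poly_approx_onem_powR p^-1 n d01).
have /andP[d0 d1] := d01.
set Q := \poly_(k < n) arc_ratio_coef k.
pose P := \poly_(k < n) binom_coef p^-1 k; rewrite -/P in HC.
have PQ y : P.[y] = Q.[y] + q * (y * Q^`().[y]).
  suff -> : P = Q + q *: ('X * Q^`()) by rewrite hornerD hornerZ hornerM hornerX.
  apply/polyP => k; rewrite coefD coefZ coefXM coef_deriv !coef_poly /arc_ratio_coef.
  have kq : q * k%:R + 1 != 0 by rewrite gt_eqF// ltr_wpDl// mulr_ge0// ltW.
  case: k kq => [|k] kq /=; first by case: ltnP => _; rewrite ?mulr0 ?addr0 ?mulr0 ?add0r ?divr1.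
  case: ltnP => _; last by rewrite mul0rn mulr0 addr0.
  by rewrite -[_ / _ *+ _]mulr_natr; move: (k.+1%:R : R) kq => K kq; field.
exists C => u /[dup] ud /andP[u0 ule].
have u1 : u < 1 by exact: le_lt_trans d1.
have /andP[s0 s1] := powR_root_itv01 u0 u1.
have sq := powRKV (ltW u0).
rewrite /arc_ratio; set s := u `^ q^-1 in s0 s1 sq *.
pose G t := F t - t * Q.[t `^ q].
have Gd t : 0 < t < s -> is_derive t (1 : R) G (f t - P.[t `^ q]).
  move=> /andP[t0 ts]; have D1 := is_derive_garcsin t0 (lt_trans ts s1).
  have D2 := is_derive1_powR q t0.
  have D3 := @is_derive1_comp R (horner Q) (fun t => t `^ q) t _ _ (is_derive_poly Q _) D2.
  have D4 := is_deriveM (is_derive_id t 1) D3.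
  apply: (trigger_derive (is_deriveB D1 D4)).
  have tq : t * t `^ (q - 1) = t `^ q by rewrite mulr_powRB1// ltW.
  rewrite PQ /GRing.scale /= mulr1 -tq; congr (_ - _).
  by ring.
have sub01 : `[0, s] `<=` `[0, 1]%classic.
  by move=> x /=; rewrite !in_itv/= => /andP[-> xs]; rewrite (le_trans xs)// ltW.
have Gc : {within `[0, s], continuous G}.
  have Fc : {within `[0, s], continuous F}.
    exact: continuous_subspaceW garcsin_within_continuous.
  have Qc : {within `[0, s], continuous (fun t => Q.[t `^ q])}.
    apply: (@within_itv_continuous_comp _ (fun t => t `^ q) (horner Q)) => //.
      exact: powR_within_continuous.
    by move=> x _; exact: continuous_horner.
  have Ic : {within `[0, s], continuous (@id R)}.
    by apply: continuous_subspaceT => x; exact: cvg_id.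
  move=> x; apply: cvgB; first exact: Fc.
  by apply: cvgM; [exact: Ic|exact: Qc].
have := @MVT_norm_le _ G (fun t => f t - P.[t `^ q]) s (C * u ^+ n) (ltW s0) Gd Gc.
have -> : G 0 = 0 by rewrite /G garcsin0 mul0r subr0.
have -> : F s / s - Q.[u] = G s / s.
  by rewrite /G sq; field; rewrite gt_eqF.
rewrite subr0 normrM normfV (gtr0_norm s0) ler_pdivrMr//; apply.
move=> t /andP[t0 ts]; have tu : t `^ q <= u.
  by rewrite -sq ge0_ler_powR ?nnegrE ?(ltW q0) ?(ltW t0) ?(ltW s0) ?(ltW ts).
have tq0 : 0 < t `^ q by rewrite powR_gt0.
rewrite (le_trans (HC (t `^ q) _))//; first by rewrite tq0 (le_trans tu).
by rewrite ler_wpM2l// lerXn2r ?nnegrE ?(ltW tq0) ?(ltW u0).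
Qed.

Lemma arc_ratio_gt1 u : 0 < u -> u < 1 -> 1 < arc_ratio u.
Proof.
move=> u0 u1; have /andP[s0 s1] := powR_root_itv01 u0 u1.
by rewrite /arc_ratio ltr_pdivlMr// mul1r garcsin_gt// ltW.
Qed.

Definition ln_remainder u : R := (ln (arc_ratio u) - arc_ratio_coef 1 * u) / u / u.

Lemma cut_integrandE s0 m s : 0 < s0 -> s0 < 1 -> 0 < s ->
  cut_integrand s0 m s =
  if s `^ q <= s0 `^ q then
    expR (- (m * (arc_ratio_coef 1 * s `^ q + ln_remainder (s `^ q) * (s `^ q) ^+ 2)))
      * (1 - s `^ q) `^ (- p^-1)
  else 0.
Proof.
move=> s00 s01 sp; rewrite /cut_integrand; case: leP => // ss.
have u0 : 0 < s `^ q by rewrite powR_gt0.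
have s1 : s <= 1.
  rewrite leNgt; apply/negP => s1.
  have : s0 `^ q < s `^ q.
    by rewrite gt0_ltr_powR ?nnegrE ?(ltW s00) ?(ltW sp)// (lt_trans s01).
  by rewrite ltNge ss.
have Fs := lt_trans sp (garcsin_gt sp s1).
congr (_ * _); rewrite /ln_remainder.
have -> : arc_ratio (s `^ q) = F s / s.
  by rewrite /arc_ratio -powRrM mulfV ?gt_eqF// powRr1 ?(ltW sp).
set u := s `^ q in u0 *.
rewrite [X in m * X](_ : _ = ln (F s / s)); last first.
  have : u != 0 by rewrite gt_eqF.
  by move: (ln _) (arc_ratio_coef 1) => L A un0; field.
rewrite /powR gt_eqF ?divr_gt0//; congr expR.
by rewrite -[s / F s]invf_div lnV ?posrE ?divr_gt0// mulrN.
Qed.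

End GeneralisedArcsine.

(** * The expansion of the integral *)

Section Assembly.
Context {R : realType} (p q : R) (hp : 1 < p) (hq : 1 < q).
Local Notation mu := (@lebesgue_measure R).
Local Notation F := (garcsin p q).

Let p0 : 0 < p. Proof. exact: lt_trans hp. Qed.
Let q0 : 0 < q. Proof. exact: lt_trans hq. Qed.

(** An exponentially small contribution does not change any approximation. *)
Lemma poly_approx_powR_mul_expR (C ka d : R) (g : R -> R) N : 0 <= C -> 0 < ka -> d <= 1 ->
  (forall x, 0 < x <= d -> `|g x| <= C * expR (- (ka * x^-1))) ->
  poly_approx d (fun x => x^-1 `^ q^-1 * g x) 0 N.
Proof.
move=> C0 ka0 d1 gC.
have [K [K0 HK]] := exprn_expR_le N.+1 (mulr_gt0 (ltr0Sn R 1) ka0).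
exists (C * K) => x /[dup] xd /andP[x0 xle].
rewrite horner0 subr0 normrM ger0_norm ?powR_ge0//.
set m := x^-1; have m0 : 0 < m by rewrite invr_gt0.
have m1 : 1 <= m by rewrite invf_ge1// (le_trans xle).
have xm : x ^+ N = m ^- N by rewrite /m exprVn invrK.
apply: (@le_trans _ _ (m * (C * expR (- (ka * m))))).
  rewrite ler_pM ?powR_ge0 ?gC//.
  by rewrite -[leRHS]powRr1 ?(ltW m0)// ler_powR// invf_le1// ltW.
rewrite xm ler_pdivlMr ?exprn_gt0//.
have := HK m (ltW m0); rewrite mulrC mulrA.
have -> : 2 * ka / 2 * m = ka * m by field.
move=> H; rewrite [leLHS](_ : _ = C * (m ^+ N.+1 * expR (- (ka * m)))); last first.
  by rewrite exprS; ring.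
rewrite ler_wpM2l// mulrC (le_trans H)// ler_piMr// -expR0 ler_expR oppr_le0.
by rewrite mulr_ge0 ?divr_ge0 ?mulr_ge0 ?(ltW ka0) ?(ltW m0).
Qed.

(** The tail beyond [F s0] is exponentially small, so [Ipq] inherits the approximations
    of the integral over [[0, s0]]; restricting to [x <= 1/2] keeps [m >= 2], where the
    tail converges. *)
Lemma Ipq_poly_approx (s0 : R) P N : 0 < s0 -> s0 < 1 ->
  (forall m, 1 <= m -> mu.-integrable `]0, +oo[ (EFin \o cut_integrand p q s0 m)) ->
  poly_approx 1 (fun x => x^-1 `^ q^-1 *
    \int[mu]_(s in `]0, +oo[) cut_integrand p q s0 x^-1 s) P N ->
  poly_approx 2^-1 (fun x => Ipq p q x^-1) P N.
Proof.
move=> s00 s01 ih main.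
have [C [ka [C0 ka0 tail]]] := gsinc_tail_integral hp hq s00 s01.
pose H m := \int[mu]_(s in `]0, +oo[) cut_integrand p q s0 m s.
pose J m := \int[mu]_(x in `[0, +oo[) (`|gsinc p q x| `^ m).
have half1 : 2^-1 <= 1 :> R by rewrite invf_le1// ler1n.
have JH m : 2 <= m -> `|J m - H m| <= C * expR (- (ka * m)).
  move=> m2; have m1 : 1 <= m by rewrite (le_trans _ m2)// ler1n.
  have [_ E] := gsinc_substitution hp hq m s00 s01.
  have F0 : 0 < F s0 by exact: lt_trans (garcsin_gt hp hq s00 (ltW s01)).
  pose T := (\int[mu]_(x in `]F s0, +oo[) (`|gsinc p q x| `^ m)%:E)%E.
  have T0 : (0 <= T)%E by apply: integral_ge0 => x _; rewrite lee_fin powR_ge0.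
  have TC := tail m m2.
  have Tfin : T \is a fin_num by rewrite ge0_fin_numE// (le_lt_trans TC)// ltry.
  have HE : (\int[mu]_(s in `]0%R, +oo[) (cut_integrand p q s0 m s)%:E)%E = (H m)%:E.
    by rewrite /H /Rintegral fineK//; apply: integrable_fin_num => //; exact: ih.
  have JE : (\int[mu]_(x in `[0%R, +oo[) (`|gsinc p q x| `^ m)%:E)%E = ((H m)%:E + T)%E.
    have setE : `[0, +oo[%classic = `[0, F s0]%classic `|` `]F s0, +oo[%classic.
      apply/seteqP; split=> x /=; rewrite !in_itv/= !andbT.
        by move=> x0; have [xF|xF] := leP x (F s0); [left; rewrite x0|right].
      by move=> [/andP[]//|xF]; rewrite (le_trans (ltW F0))// ltW.
    rewrite setE ge0_integral_setU//.
    - by rewrite E HE.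
    - by rewrite -setE; apply/measurable_EFinP; exact: measurable_gsinc_powR.
    - apply/disj_setPS => x [/=]; rewrite !in_itv/= andbT => /andP[_ xF].
      by rewrite ltNge xF.
  rewrite /J /Rintegral JE fineD// addrAC subrr add0r.
  rewrite ger0_norm; last exact: fine_ge0.
  by rewrite -lee_fin fineK.
have t0 := @poly_approx_powR_mul_expR C ka 2^-1 (fun x => J x^-1 - H x^-1) N C0 ka0 half1.
have main2 := poly_approx_restr half1 main.
rewrite -[P]addr0; apply: poly_approx_ext (poly_approxD main2 (t0 _)).
  by move=> x _; rewrite /Ipq -/(J _) -/(H _); ring.
move=> x /andP[x0 xle]; apply: JH.
by rewrite -[leLHS]invrK lef_pV2 ?posrE ?invr_gt0.
Qed.

(** The error [O (x^(K + 1))] at [x = 1 / m] is [o (m^(- N))] for every [N <= K]. *)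
Lemma poly_approx_asymp (g : R -> R) (e : nat -> R) d N K : 0 < d -> (N <= K)%N ->
  e 0%N != 0 ->
  poly_approx d (fun x => g x^-1) (\poly_(k < K.+1) e k) K.+1 ->
  asymp_equiv g (fun m => (\poly_(k < K.+1) e k).[m^-1]) /\
  (g m - (\poly_(k < K.+1) e k).[m^-1]) * m ^+ N @[m --> +oo] --> (0 : R).
Proof.
move=> d0 NK e0 /poly_approxP[C [C0 HC]].
set P := \poly_(k < K.+1) e k in HC *.
have invy : m^-1 @[m --> +oo] --> (0 : R).
  apply/gtr0_cvgV0; last exact: cvg_id.
  by near=> m; near: m; exact: nbhs_pinfty_gt.
have bnd : \forall m \near +oo, forall n, (n <= K)%N ->
    `|(g m - P.[m^-1]) * m ^+ n| <= C * m^-1.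
  near=> m => n nK.
  have m1 : 1 <= m by near: m; exact: nbhs_pinfty_ge.
  have md : d^-1 <= m by near: m; apply: nbhs_pinfty_ge; exact: num_real.
  have m0 : 0 < m := lt_le_trans ltr01 m1.
  have := HC m^-1; rewrite invr_gt0 m0 invf_ple ?posrE// md invrK => /(_ isT) H.
  rewrite normrM normrX (gtr0_norm m0).
  rewrite (le_trans (ler_wpM2r (exprn_ge0 n (ltW m0)) H))//.
  rewrite exprS -!mulrA ler_wpM2l// ler_piMr ?invr_ge0 ?(ltW m0)//.
  by rewrite exprVn mulrC ler_pdivrMr ?exprn_gt0// mul1r ler_weXn2l.
have lim n : (n <= K)%N -> (g m - P.[m^-1]) * m ^+ n @[m --> +oo] --> (0 : R).
  move=> nK; apply: norm_cvg0; apply: (@squeeze_cvgr _ _ _ _ (cst 0) (fun m => C * m^-1)).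
  - near=> m; rewrite normr_ge0 /=.
    by move: nK; move: (n); near: m; exact: bnd.
  - exact: cvg_cst.
  - by rewrite -[X in _ --> X](mulr0 C); apply: cvgMl_tmp.
split; last exact: lim.
have Pl : P.[m^-1] @[m --> +oo] --> e 0%N.
  have -> : e 0%N = P.[0] by rewrite horner_coef0 coef_poly.
  by apply: continuous_cvg invy; exact: continuous_horner.
have gl : g m @[m --> +oo] --> e 0%N.
  have gE : g = fun m => (g m - P.[m^-1]) * m ^+ 0 + P.[m^-1].
    by apply/funext => m; rewrite expr0 mulr1 subrK.
  rewrite gE -[e 0%N]add0r; apply: cvgD; last exact: Pl.
  exact: lim.
rewrite /asymp_equiv -(divff e0); apply: cvgM => //.
exact: cvgV.
Unshelve. all: by end_near.
Qed.

Local Notation c1 := (arc_ratio_coef p q 1).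
Local Notation c2 := (arc_ratio_coef p q 2).

Lemma arc_ratio_coefE :
  [/\ arc_ratio_coef p q 0 = 1, c1 = (p * (q + 1))^-1 &
      c2 = (1 + p) / (2 * p ^+ 2 * (2 * q + 1))].
Proof.
have pn : p != 0 by rewrite gt_eqF.
have q1 : q + 1 != 0 by rewrite gt_eqF// addr_gt0.
have q2 : 2 * q + 1 != 0 by rewrite gt_eqF// addr_gt0// mulr_gt0.
rewrite /arc_ratio_coef /binom_coef big_ord0 !big_ord_recl !big_ord0 /= /bump /=.
rewrite !factS fact0 !muln1 !mulr0 !add0r !addr0 !mulr1 !divr1; split=> //.
  by field; rewrite pn q1.
by rewrite addn0; field; rewrite pn q2.
Qed.

(** The cut-off [d] is chosen so small that [|r u| u <= a / 2] on [(0, d]]; the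
    coefficients of [1] and [1 / m] are read off the approximation of order two. *)
Lemma Ipq_expansion : exists e : nat -> R,
  [/\ forall N, poly_approx 2^-1 (fun x => Ipq p q x^-1) (\poly_(k < N) e k) N,
   e 0%N = q^-1 * Gamma q^-1 * (p * (q + 1)) `^ q^-1 &
   e 1%N = - (q^-1 * Gamma q^-1 * (p * (q + 1)) `^ q^-1 *
     ((q + 1) * (p * q ^+ 2 + 2 * p * q - 3 * q ^+ 2 + p - 2 * q)
        / (2 * q ^+ 2 * (2 * q + 1))))].
Proof.
have [c0E c1E c2E] := arc_ratio_coefE.
have a0 : 0 < c1 by rewrite c1E invr_gt0 mulr_gt0// addr_gt0.
have half01 : 0 < (2^-1 : R) < 1 by rewrite invr_gt0 invf_lt1// ltr1n ltr0n.
have /andP[half0 half1] := half01.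
have ratio1 u : 0 < u <= 2^-1 -> 1 < arc_ratio p q u.
  by move=> /andP[u0 uh]; apply: arc_ratio_gt1 => //; exact: le_lt_trans half1.
have rP n := poly_approx_ln_remainder half0 ratio1 c0E
  (fun n => arc_ratio_approx hp hq n half01) n.
have [B [B0 HB]] : bounded_on 2^-1 (ln_remainder p q).
  by have [P [rP0 _]] := rP 0%N; exact: poly_approx_bounded rP0.
pose d := Num.min 2^-1 (c1 / (2 * (B + 1))).
have B1 : 0 < 2 * (B + 1) by rewrite mulr_gt0// ltr_wpDl.
have d0 : 0 < d by rewrite lt_min half0 divr_gt0.
have dh : d <= 2^-1 by rewrite ge_min lexx.
have d1 : d < 1 by exact: le_lt_trans half1.
have rB u : 0 < u <= d -> `|ln_remainder p q u| <= B.
  by move=> /andP[u0 ud]; apply: HB; rewrite u0 (le_trans ud).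
have rsmall u : 0 < u <= d -> `|ln_remainder p q u| * u <= c1 / 2.
  move=> /[dup] ud /andP[u0 ule].
  rewrite (le_trans (ler_pM _ (ltW u0) (rB u ud) ule))//.
  apply: (@le_trans _ _ (B * (c1 / (2 * (B + 1))))).
    by rewrite ler_wpM2l// ge_min lexx orbT.
  have B1' : B + 1 != 0 by rewrite gt_eqF// ltr_wpDl.
  rewrite [leRHS](_ : _ = (B + 1) * (c1 / (2 * (B + 1)))); last by field.
  by rewrite ler_wpM2r ?lerDl// divr_ge0 ?(ltW a0) ?(ltW B1).
pose fd (u : R) : R := (1 - u) `^ (- p^-1).
have fP n : poly_approx d fd (\poly_(k < n) binom_coef p^-1 k) n.
  by apply: poly_approx_onem_powR; rewrite d0.
have gP l n : exists P, poly_approx d (fun u => ln_remainder p q u ^+ l * fd u) P n.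
  have [P [rPn _]] := rP n; exists (P ^+ l * \poly_(k < n) binom_coef p^-1 k).
  apply: poly_approxM (fP n); apply: poly_approxX; apply: poly_approx_restr dh _.
  by apply: poly_approx_le rPn => //; exact: ltW.
have /choice[c HcS] : forall l, exists c : nat -> R, forall n,
    poly_approx d (fun u => ln_remainder p q u ^+ l * fd u) (\poly_(k < n) c k) n.
  by move=> l; apply: poly_approx_series => // n; exact: gP.
pose s0 := d `^ q^-1.
have /andP[s00 s01] : 0 < s0 < 1 by exact: powR_root_itv01.
have s0q : s0 `^ q = d by apply: powRKV => //; exact: ltW.
have IP N : poly_approx 2^-1 (fun x => Ipq p q x^-1) (laplace_poly q c1 c N) N.
  have rbd : bounded_on d (ln_remainder p q) by exists B.
  have fbd : bounded_on d fd by exact: poly_approx_bounded (fP 0%N).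
  have [C [C0 HC]] := laplace_pointwise d0 a0 rbd fbd rsmall (fun l => HcS l N).
  have [||ih main] := @laplace_integral _ q c1 c N (cut_integrand p q s0) hq a0.
  - by move=> m m1; exact: (gsinc_substitution hp hq m s00 s01).1.
  - exists C; split=> // m s m1 sp; rewrite cut_integrandE// s0q.
    by have /= := HC (m, s `^ q); apply; split=> //; exact: powR_gt0.
  exact: (Ipq_poly_approx s00 s01).
have [|e He] := @poly_approx_series _ 2^-1 (fun x => Ipq p q x^-1) half0.
  by move=> N; exists (laplace_poly q c1 c N); exact: IP.
have eE k : (k < 2)%N -> e k = (laplace_poly q c1 c 2)`_k.
  move=> k2; rewrite -(poly_approx_coef half0 (He 2%N) (IP 2%N) k2).
  by rewrite coef_poly k2.
have c0E' k : (k < 2)%N -> c 0%N k = binom_coef p^-1 k.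
  move=> k2; have fP' : poly_approx d fd (\poly_(j < 2) c 0%N j) 2.
    by apply: poly_approx_ext (HcS 0%N 2%N) => u _; rewrite expr0 mul1r.
  by have := poly_approx_coef d0 fP' (fP 2%N) k2; rewrite !coef_poly k2.
have c10 : c 1%N 0%N = c2 - c1 ^+ 2 / 2.
  have [P [P1 P0]] := rP 0%N.
  have rfP : poly_approx d (fun u => ln_remainder p q u ^+ 1 * fd u)
      (P * \poly_(k < 1) binom_coef p^-1 k) 1.
    by apply: poly_approxM (fP 1%N); exact: poly_approx_restr dh P1.
  have := poly_approx_coef d0 (HcS 1%N 1%N) rfP (ltn0Sn 0).
  rewrite coef_poly /= => ->; rewrite coef0M P0 coef_poly /=.
  by rewrite /binom_coef big_ord0 fact0 divr1 mulr1.
have b0 : binom_coef p^-1 0 = 1 by rewrite /binom_coef big_ord0 fact0 divr1.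
have b1 : binom_coef p^-1 1 = p^-1.
  by rewrite /binom_coef big_ord_recl big_ord0 /= addr0 mulr1 divr1.
have G1 : Gamma (1%:R + q^-1) = q^-1 * Gamma q^-1.
  by rewrite (Gamma_succ 0 hq) add0r.
have G2 : Gamma (2%:R + q^-1) = (1 + q^-1) * (q^-1 * Gamma q^-1).
  by rewrite (Gamma_succ 1 hq) G1.
have cS : c1 `^ (- q^-1) = (p * (q + 1)) `^ q^-1.
  rewrite c1E -powR_inv1 ?mulr_ge0 ?addr_ge0 ?(ltW p0) ?(ltW q0)//.
  by rewrite -powRrM mulrNN mul1r.
exists e; split=> //.
- rewrite eE// /laplace_poly !(big_ord_recl, big_ord0) !coefE /=.
  rewrite /bump /= !(mulr0, addr0) mulr1 muln0 addn0 !expr0 fact0 !divr1 !mul1r add0r.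
  by rewrite c0E'// b0 mul1r cS [_ / q]mulrC.
- rewrite eE// /laplace_poly !(big_ord_recl, big_ord0) !coefE /=.
  rewrite /bump /= !(mulr0, addr0, add0r, muln0, muln1, addn0, add0n, expr0, expr1, fact0, factS).
  rewrite !(divr1, mulr1, mul1r) c0E'// b1 c10 G1 G2 cS c1E c2E.
  have pn : p != 0 by rewrite gt_eqF.
  have qn : q != 0 by rewrite gt_eqF.
  have q1 : q + 1 != 0 by rewrite gt_eqF// addr_gt0.
  have q2 : 2 * q + 1 != 0 by rewrite gt_eqF// addr_gt0// mulr_gt0.
  by field; rewrite pn qn q1 q2.
Qed.

End Assembly.

Theorem theorem2p1 (R : realType) (p q : R) (hp : 1 < p) (hq : 1 < q) :
  exists gamma : nat -> R,
    asymp_series (Ipq p q)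
      (fun (N : nat) (m : R) =>
         q^-1 * Gamma q^-1 * (p * (q + 1)) `^ q^-1 *
           (1 - (q + 1) * (p * q ^+ 2 + 2 * p * q - 3 * q ^+ 2 + p - 2 * q)
                / (2 * q ^+ 2 * (2 * q + 1)) * m^-1)
         + q^-1 * \sum_(2 <= j < N.+1)
                    Gamma (j%:R + q^-1) * (gamma j / m ^+ j)).
Proof.
have p0 : 0 < p := lt_trans ltr01 hp.
have q0 : 0 < q := lt_trans ltr01 hq.
have [e [He e0 e1]] := Ipq_expansion hp hq.
have e00 : e 0%N != 0.
  rewrite e0 gt_eqF// !mulr_gt0 ?invr_gt0 ?powR_gt0 ?mulr_gt0 ?addr_gt0//.
  by have := Gamma_gt0 0 hq; rewrite add0r.
exists (fun j => q * e j / Gamma (j%:R + q^-1)).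
set S := (S in asymp_series _ S).
(* The order [0] partial sum already contains the term in [1 / m], hence [maxn N 1]. *)
suff -> : S = fun N m => (\poly_(k < (maxn N 1).+1) e k).[m^-1].
  have half0 : 0 < 2^-1 :> R by rewrite invr_gt0.
  by move=> N; exact: (poly_approx_asymp half0 (leq_maxl N 1) e00 (He _)).
apply/funext => N; apply/funext => m; rewrite /S horner_poly.
pose K := maxn N 1; rewrite -/K.
have -> : \sum_(2 <= j < N.+1) Gamma (j%:R + q^-1) *
    (q * e j / Gamma (j%:R + q^-1) / m ^+ j) =
    q * \sum_(2 <= j < K.+1) e j * m^-1 ^+ j.
  rewrite (_ : \sum_(2 <= j < N.+1) _ = \sum_(2 <= j < K.+1)
    Gamma (j%:R + q^-1) * (q * e j / Gamma (j%:R + q^-1) / m ^+ j)); last first.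
    by rewrite /K; case: (N) => [|n]; [rewrite max0n !big_geq|rewrite (maxn_idPl _)].
  rewrite mulr_sumr; apply: eq_bigr => j _.
  have G0 : Gamma (j%:R + q^-1) != 0 by rewrite gt_eqF// Gamma_gt0.
  by rewrite exprVn; move: (m ^- j) => I; field.
rewrite mulKf ?gt_eqF//.
rewrite -(big_mkord xpredT (fun i => e i * m^-1 ^+ i)).
have K1 : (1 <= K)%N by rewrite leq_maxr.
rewrite big_ltn// big_ltn// addrA e0 e1 expr0 expr1; congr (_ + _).
by ring.
Qed.
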